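(* Let $M$ be a nondegenerate $(g,F,\mu)$-manifold with $\mu=+1$ whose tensor field $F$ is parallel, and let $N$ be a semi-invariant submanifold of $M$. Then the $F$-anti-invariant distribution $D^{\perp}$ of $N$ is integrable.
   Context: All objects are smooth; $\Gamma(V)$ denotes the smooth sections of a vector bundle $V$. For $\mu\in\{-1,+1\}$, a $(g,F,\mu)$-manifold is a manifold $M$ with a Riemannian metric $g$ and a $(1,1)$-tensor field $F$ such that $g(FX,Y)+\mu g(X,FY)=0$ for all vector fields $X,Y$ on $M$. It is nondegenerate if $F_x:T_xM\to T_xM$ is nondegenerate (invertible) at every $x\in M$. $F$ is parallel if $\widetilde\nabla F=0$, where $\widetilde\nabla$ is the Levi-Civita connection of $(M,g)$. A submanifold $N$ of $M$ (with induced metric, also denoted $g$, and normal bundle $T^{\perp}N$) is semi-invariant if there is a distribution $D$ on $N$ such that: (i) $F(D_x)\subset D_x$ for all $x\in N$; (ii) the orthogonal complement $D^{\perp}$ of $D$ in $TN$ satisfies $F(D^{\perp}_x)\subset T^{\perp}_xN$ for all $x\in N$; (iii) $F^2(D^{\perp})$ is a distribution on $N$ (a subbundle of $TN$). $D$ is called the $F$-invariant and $D^\perp$ the $F$-anti-invariant distribution of $N$. *)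

(* Defs.v *)
From HB Require Import structures.
From mathcomp Require Import all_boot all_order all_algebra.
From mathcomp Require Import all_classical all_reals.
From mathcomp Require Import topology normedtype derive.

Set Implicit Arguments.
Unset Strict Implicit.
Unset Printing Implicit Defensive.

Import Order.TTheory GRing.Theory Num.Theory.
Import numFieldNormedType.Exports.

Local Open Scope classical_set_scope.
Local Open Scope ring_scope.

(* C^infinity on U (meant for open U): every iterated directional derivative
   is Frechet differentiable at every point of U. *)
Definition smooth_on (R : realType) (n : nat) (W : normedModType R)
    (U : set 'rV[R]_n) (f : 'rV[R]_n -> W) : Prop :=
  forall (s : seq 'rV[R]_n) (x : 'rV[R]_n), U x ->
    differentiable (foldr (fun v h => 'D_v h) f s) x.

Record chart (R : realType) (n : nat) (T : topologicalType) := Chart {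
  cdom : set T;
  cmap : T -> 'rV[R]_n;
  cinv : 'rV[R]_n -> T;
  cdom_open : open cdom;
  cimg_open : open (cmap @` cdom);
  cmapK : forall p, cdom p -> cinv (cmap p) = p;
  cmap_continuous : forall p, cdom p -> {for p, continuous cmap};
  cinv_continuous :
    forall x, (cmap @` cdom) x -> {for x, continuous cinv} }.

(* A smooth n-manifold.  [chart_at] selects one chart of the atlas around each
   point; the tangent space at p is the type 'rV[R]_n, a tangent vector being
   given by its components in the chart [chart_at p]. *)
Record manifold (R : realType) (n : nat) := Manifold {
  mcarrier :> topologicalType;
  atlas : set (chart R n mcarrier);
  chart_at : mcarrier -> chart R n mcarrier;
  chart_at_atlas : forall p, atlas (chart_at p);
  chart_at_dom : forall p, cdom (chart_at p) p;
  atlas_compatible : forall c c', atlas c -> atlas c' ->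
    smooth_on (cmap c @` (cdom c `&` cdom c')) (cmap c' \o cinv c);
  manifold_hausdorff : hausdorff_space mcarrier;
  manifold_second_countable : @second_countable mcarrier }.

Definition smooth_fun (R : realType) (n : nat) (M : manifold R n)
    (U : set M) (f : M -> R) : Prop :=
  forall c, atlas c ->
    @smooth_on R n R^o (cmap c @` (cdom c `&` U)) (f \o cinv c).

Definition smooth_map (R : realType) (n m : nat) (N : manifold R n)
    (M : manifold R m) (f : N -> M) : Prop :=
  continuous f /\
  forall c c', atlas c -> atlas c' ->
    smooth_on (cmap c @` (cdom c `&` f @^-1` cdom c'))
              (cmap c' \o f \o cinv c).

(* Matrix (acting on row vectors from the right) of the differential
   T_pN -> T_(f p)M. *)
Definition tangent_map (R : realType) (n m : nat) (N : manifold R n)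
    (M : manifold R m) (f : N -> M) (p : N) : 'M[R]_(n, m) :=
  'J (cmap (chart_at (f p)) \o f \o cinv (chart_at p)) (cmap (chart_at p) p).

(* A submanifold is given by its inclusion map, an injective immersion. *)
Definition submanifold (R : realType) (n m : nat) (N : manifold R n)
    (M : manifold R m) (i : N -> M) : Prop :=
  [/\ smooth_map i, injective i & forall p, row_free (tangent_map i p)].

Section Fields.
Variables (R : realType) (n : nat) (M : manifold R n).

Implicit Types (U : set M) (X Y Z : M -> 'rV[R]_n).

(* Components of X in the chart c, as a function on the image of c. *)
Definition vf_in_chart X (c : chart R n M) (x : 'rV[R]_n) : 'rV[R]_n :=
  X (cinv c x) *m
    'J (cmap c \o cinv (chart_at (cinv c x))) (cmap (chart_at (cinv c x)) (cinv c x)).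

Definition smooth_vf U X : Prop :=
  forall c, atlas c ->
    smooth_on (cmap c @` (cdom c `&` U)) (vf_in_chart X c).

(* The derivative X f of a function along a vector field. *)
Definition vf_deriv X (f : M -> R) (p : M) : R :=
  @derive R _ R^o (f \o cinv (chart_at p)) (cmap (chart_at p) p) (X p).

(* [X, Y]^k = X^j d_j Y^k - Y^j d_j X^k, in the chart selected at p. *)
Definition lie_bracket X Y (p : M) : 'rV[R]_n :=
  let c := chart_at p in
  'D_(X p) (vf_in_chart Y c) (cmap c p) - 'D_(Y p) (vf_in_chart X c) (cmap c p).

(* Gram matrix g p of the inner product on T_pM. *)
Definition inner (g : M -> 'M[R]_n) (p : M) (v w : 'rV[R]_n) : R :=
  (v *m g p *m w^T) ord0 ord0.

Definition riemannian_metric (g : M -> 'M[R]_n) : Prop :=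
  [/\ forall p v w, inner g p v w = inner g p w v,
      forall p v, v != 0 -> 0 < inner g p v v
    & forall U X Y, open U -> smooth_vf U X -> smooth_vf U Y ->
        smooth_fun U (fun p => inner g p (X p) (Y p))].

(* F p is the matrix of F_p : T_pM -> T_pM, acting as v |-> v *m F p. *)
Definition tensor11 (F : M -> 'M[R]_n) : Prop :=
  forall U X, open U -> smooth_vf U X -> smooth_vf U (fun p => X p *m F p).

Definition gFmu_manifold (g F : M -> 'M[R]_n) (mu : R) : Prop :=
  [/\ mu = -1 \/ mu = 1,
      riemannian_metric g,
      tensor11 F
    & forall p v w,
        inner g p (v *m F p) w + mu * inner g p v (w *m F p) = 0].

Definition nondegenerate_tensor (F : M -> 'M[R]_n) : Prop :=
  forall p, F p \in unitmx.

(* A linear connection, as a family of operators on the smooth vector fields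
   of all open sets that is compatible with restriction.  The family is encoded
   by one operator on arbitrary maps; nothing is required of its values away
   from the open sets on which the arguments are smooth. *)
Definition linear_connection
    (nabla : (M -> 'rV[R]_n) -> (M -> 'rV[R]_n) -> M -> 'rV[R]_n) : Prop :=
  forall U, open U ->
  [/\ forall X X' Y Y', smooth_vf U X -> smooth_vf U Y ->
        {in U, X =1 X'} -> {in U, Y =1 Y'} ->
        {in U, nabla X Y =1 nabla X' Y'},
      forall X Y, smooth_vf U X -> smooth_vf U Y -> smooth_vf U (nabla X Y),
      forall f X X' Y, smooth_fun U f ->
        smooth_vf U X -> smooth_vf U X' -> smooth_vf U Y ->
        forall p, U p ->
        nabla (fun q => f q *: X q + X' q) Y p = f p *: nabla X Y p + nabla X' Y p
    & forall f X Y Y', smooth_fun U f ->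
        smooth_vf U X -> smooth_vf U Y -> smooth_vf U Y' ->
        forall p, U p ->
        nabla X (fun q => f q *: Y q + Y' q) p =
          vf_deriv X f p *: Y p + f p *: nabla X Y p + nabla X Y' p].

Definition levi_civita (g : M -> 'M[R]_n)
    (nabla : (M -> 'rV[R]_n) -> (M -> 'rV[R]_n) -> M -> 'rV[R]_n) : Prop :=
  [/\ linear_connection nabla,
      forall U X Y, open U -> smooth_vf U X -> smooth_vf U Y ->
        forall p, U p -> nabla X Y p - nabla Y X p = lie_bracket X Y p
    & forall U X Y Z, open U ->
        smooth_vf U X -> smooth_vf U Y -> smooth_vf U Z ->
        forall p, U p ->
        vf_deriv X (fun q => inner g q (Y q) (Z q)) p =
          inner g p (nabla X Y p) (Z p) + inner g p (Y p) (nabla X Z p)].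

Definition parallel
    (nabla : (M -> 'rV[R]_n) -> (M -> 'rV[R]_n) -> M -> 'rV[R]_n)
    (F : M -> 'M[R]_n) : Prop :=
  forall U X Y, open U -> smooth_vf U X -> smooth_vf U Y ->
    forall p, U p ->
    nabla X (fun q => Y q *m F q) p - nabla X Y p *m F p = 0.

(* A subbundle of TM of constant rank: around every point it is spanned by a
   smooth local frame, whose members are the rows of X. *)
Definition distribution (D : M -> set 'rV[R]_n) : Prop :=
  exists k : nat, forall p0 : M,
    exists (U : set M) (X : M -> 'M[R]_(k, n)),
      [/\ open U, U p0,
          forall a : 'I_k, smooth_vf U (fun p => row a (X p))
        & forall p, U p ->
            row_free (X p) /\ D p = [set v | (v <= X p)%MS]].

Definition orth_complement (g : M -> 'M[R]_n) (D : M -> set 'rV[R]_n) (p : M) :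
    set 'rV[R]_n :=
  [set v | forall w, D p w -> inner g p v w = 0].

(* Through every point passes an integral manifold, i.e. a submanifold whose
   tangent spaces are the spaces of D. *)
Definition integrable_distribution (D : M -> set 'rV[R]_n) : Prop :=
  forall p : M, exists (k : nat) (S : manifold R k) (j : S -> M),
    [/\ submanifold j,
        exists s, j s = p
      & forall s, [set v *m tangent_map j s | v in [set: 'rV[R]_k]] = D (j s)].

End Fields.

Section Submanifold.
Variables (R : realType) (m n : nat) (M : manifold R m) (N : manifold R n).
Variables (g F : M -> 'M[R]_m) (i : N -> M).

Definition induced_metric (x : N) : 'M[R]_n :=
  tangent_map i x *m g (i x) *m (tangent_map i x)^T.

(* T_xN and its subspaces are viewed inside T_(i x)M through tangent_map i x. *)
Definition normal_space (x : N) : set 'rV[R]_m :=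
  [set w | forall u : 'rV[R]_n, inner g (i x) w (u *m tangent_map i x) = 0].

Definition semi_invariant (D : N -> set 'rV[R]_n) : Prop :=
  let Dperp := orth_complement induced_metric D in
  [/\ distribution D,
      forall x, [set v *m tangent_map i x *m F (i x) | v in D x] `<=`
                [set v *m tangent_map i x | v in D x],
      forall x, [set v *m tangent_map i x *m F (i x) | v in Dperp x] `<=`
                normal_space x
    & exists2 E : N -> set 'rV[R]_n, distribution E &
        forall x,
          [set v *m tangent_map i x *m F (i x) *m F (i x) | v in Dperp x] =
          [set v *m tangent_map i x | v in E x]].

End Submanifold.

(* Main.v *)
(* The 2-form Omega(X, Y) = g(FX, Y) is closed on M because F is skew and parallel.
   At each point of N the kernel of its pullback to N is exactly Dperp:
   anti-invariance gives one inclusion, and for the other one F maps D onto D,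
   so that g(FX, D) = 0 means that X is orthogonal to D. The kernel of a closed
   2-form of constant rank is involutive, hence integrable by Frobenius.
   Locally the kernel has a commuting frame Q_1, ..., Q_k (normalised by
   Q Pi = 1 for a constant matrix Pi, so that brackets, which are annihilated
   by Pi, vanish), and an integral manifold is the solution gamma of
   d gamma = Q(gamma), obtained by integrating the frame along rays. *)
From HB Require Import structures.
Require Import Defs.
From mathcomp Require Import all_boot all_order all_algebra.
From mathcomp Require Import all_classical all_reals.
From mathcomp Require Import topology normedtype landau sequences derive.
From mathcomp Require Import measure lebesgue_measure lebesgue_integral ftc.
From mathcomp Require Import ring.

Set Implicit Arguments.
Unset Strict Implicit.
Unset Printing Implicit Defensive.

Import Order.TTheory GRing.Theory Num.Theory.
Import numFieldNormedType.Exports.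

Local Open Scope classical_set_scope.
Local Open Scope ring_scope.

(** * Smooth functions on open sets *)

(** The constant rank of the pulled-back form is not visible on its own matrix [w]. Multiplying [w]
    by the transposed frame of [D] gives a matrix of full column rank with the same kernel: the
    kernel frame is cut out of this product, while closedness is used on [w]. Solving d gamma =
    Q(gamma) would usually rest on smooth dependence of flows on parameters. Here one curve is
    solved on [0, 1] for each small [s], a Gronwall comparison of two such curves gives the
    first-order expansion of gamma with a quadratic error, and the equation itself then raises
    differentiability to smoothness. The matrix [Pi] serves twice: it also gives gamma(s) Pi = s +
    constant, hence an injective leaf. Tangent vectors are components in a preferred chart that
    varies with the point without any continuity, so everything differential is done in one fixed
    chart, and Jacobians of chart changes translate the result. *)

Section SmoothAlgebra.
Variables (R : realType) (n : nat) (U : set 'rV[R]_n).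
Hypothesis oU : open U.

Lemma open_near (x : 'rV[R]_n) : U x -> \forall y \near x, U y.
Proof. by move=> Ux; exact: (open_nbhs_nbhs (conj oU Ux)). Qed.

Lemma differentiable_eq_on (W : normedModType R) (f g : 'rV[R]_n -> W) x :
  (forall y, U y -> f y = g y) -> U x -> differentiable f x -> differentiable g x.
Proof.
move=> fg Ux /diff_locallyP[cdf /eqaddoP dfE].
have dgE : g \o shift x = cst (g x) + 'd f x +o_ (0 : 'rV[R]_n) id.
  have nU : \forall h \near (0 : 'rV[R]_n), U (h + x).
    rewrite (near_shift x); apply: filterS (open_near Ux) => y.
    by rewrite /= sub0r subrK.
  apply/eqaddoP => e e0; apply: filterS2 (dfE e e0) nU => h + Uh.
  rewrite -[X in `|X| <= _ -> _]/(f (h + x) - (f x + 'd f x h)) !fg//.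
have dg := diff_unique cdf dgE.
by apply/diff_locallyP; rewrite dg.
Qed.

Lemma derive_eq_on (W : normedModType R) (f g : 'rV[R]_n -> W) v x :
  (forall y, U y -> f y = g y) -> U x -> 'D_v f x = 'D_v g x.
Proof.
move=> fg Ux; apply: near_eq_derive; near=> y; apply: fg.
by near: y; exact: open_near.
Unshelve. all: by end_near. Qed.

Lemma smooth_onS (W : normedModType R) (U' : set 'rV[R]_n) (f : 'rV[R]_n -> W) :
  U' `<=` U -> smooth_on U f -> smooth_on U' f.
Proof. by move=> sU sf s x /sU; exact: sf. Qed.

Lemma smooth_on_diff (W : normedModType R) (f : 'rV[R]_n -> W) x :
  smooth_on U f -> U x -> differentiable f x.
Proof. by move=> /(_ [::] x). Qed.

Lemma smooth_on_derive (W : normedModType R) (f : 'rV[R]_n -> W) v :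
  smooth_on U f -> smooth_on U ('D_v f).
Proof.
move=> sf s x Ux; have := sf (rcons s v) x Ux.
by rewrite foldr_rcons.
Qed.

Lemma smooth_on_ext (W : normedModType R) (f g : 'rV[R]_n -> W) :
  (forall y, U y -> f y = g y) -> smooth_on U f -> smooth_on U g.
Proof.
move=> fg sf s x Ux.
have fgs y : U y -> foldr (fun v h => 'D_v h) f s y = foldr (fun v h => 'D_v h) g s y.
  elim: s y {x Ux} => [|v s IHs] y Uy /=; first exact: fg.
  exact: derive_eq_on.
exact: differentiable_eq_on (fgs) Ux (sf s x Ux).
Qed.

(** Smoothness asks for every iterated derivative, and a direct induction on the list of directions
    stalls at products, whose derivatives have another shape. The algebra generated by [G] absorbs
    these shapes. [alg_ext] compares on [U] only, since the derivative formulas hold only there. *)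
Inductive alg (G : set ('rV[R]_n -> R^o)) : ('rV[R]_n -> R^o) -> Prop :=
| alg_gen f : G f -> alg G f
| alg_cst (c : R) : alg G (cst c)
| alg_add f g : alg G f -> alg G g -> alg G (fun x => f x + g x)
| alg_mul f g : alg G f -> alg G g -> alg G (fun x => f x * g x)
| alg_ext f g : alg G f -> (forall x, U x -> f x = g x) -> alg G g.

(** The Leibniz rule carries the hypothesis from the generators to the whole algebra, which is then
    stable under every ['D_v], so iterated derivatives never leave it. Inverses, compositions and
    flows each reduce to a choice of [G]. *)
Lemma alg_smooth (G : set ('rV[R]_n -> R^o)) :
  (forall f, G f -> (forall x, U x -> differentiable f x) /\
                    forall v, alg G ('D_v f)) ->
  forall f, alg G f -> smooth_on U f.
Proof.
move=> HG.
have step f : alg G f -> (forall x, U x -> differentiable f x) /\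
                    forall v, alg G ('D_v f).
  elim => {f} [f /HG //|c|f g Af [df Df] Ag [dg Dg]|f g Af [df Df] Ag [dg Dg]|f g Af [df Df] fg].
  - split=> [x _|v]; first exact: differentiable_cst.
    apply: (alg_ext (alg_cst G 0)) => x _.
    by rewrite derive_cst.
  - split=> [x Ux|v]; first exact: differentiableD (df _ Ux) (dg _ Ux).
    apply: (alg_ext (alg_add (Df v) (Dg v))) => x Ux.
    by rewrite -[RHS]/('D_v (f + g) x) deriveD//; apply: diff_derivable; auto.
  - split=> [x Ux|v]; first exact: differentiableM (df _ Ux) (dg _ Ux).
    apply: (alg_ext (alg_add (alg_mul Af (Dg v)) (alg_mul Ag (Df v)))) => x Ux.
    by rewrite -[RHS]/('D_v (f * g) x) deriveM//; apply: diff_derivable; auto.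
  - split=> [x Ux|v]; first exact: differentiable_eq_on fg Ux (df _ Ux).
    by apply: (alg_ext (Df v)) => x Ux; exact: derive_eq_on.
move=> f Af s; suff /step[] : alg G (foldr (fun v h => 'D_v h) f s) by [].
by elim: s => //= v s /step[].
Qed.

Lemma alg_sum (G : set ('rV[R]_n -> R^o)) (I : Type) (r : seq I)
    (P : pred I) (f : I -> 'rV[R]_n -> R^o) :
  (forall i, alg G (f i)) -> alg G (fun x => \sum_(i <- r | P i) f i x).
Proof.
move=> Gf; elim: r => [|i r IHr].
  by apply: (alg_ext (alg_cst G 0)) => x _; rewrite big_nil.
case Pi: (P i); last by apply: (alg_ext IHr) => x _; rewrite big_cons Pi.
by apply: (alg_ext (alg_add (Gf i) IHr)) => x _; rewrite big_cons Pi.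
Qed.

Lemma alg_prod (G : set ('rV[R]_n -> R^o)) (I : Type) (r : seq I)
    (P : pred I) (f : I -> 'rV[R]_n -> R^o) :
  (forall i, alg G (f i)) -> alg G (fun x => \prod_(i <- r | P i) f i x).
Proof.
move=> Gf; elim: r => [|i r IHr].
  by apply: (alg_ext (alg_cst G 1)) => x _; rewrite big_nil.
case Pi: (P i); last by apply: (alg_ext IHr) => x _; rewrite big_cons Pi.
by apply: (alg_ext (alg_mul (Gf i) IHr)) => x _; rewrite big_cons Pi.
Qed.

Let smooths : set ('rV[R]_n -> R^o) := smooth_on U.

Lemma smooth_alg f : alg smooths f -> smooth_on U f.
Proof.
apply: alg_smooth => {}f sf; split=> [x|v]; first exact: smooth_on_diff.
by apply: alg_gen; exact: smooth_on_derive.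
Qed.

Lemma smooth_cst (c : R) : @smooth_on R n R^o U (cst c).
Proof. exact: smooth_alg (alg_cst _ c). Qed.

Lemma smooth_mul (f g : 'rV[R]_n -> R^o) :
  smooth_on U f -> smooth_on U g -> @smooth_on R n R^o U (fun x => f x * g x).
Proof. by move=> sf sg; apply/smooth_alg/alg_mul; exact: alg_gen. Qed.

Lemma smooth_sum (I : Type) (r : seq I) (P : pred I) (f : I -> 'rV[R]_n -> R^o) :
  (forall i, smooth_on U (f i)) ->
  @smooth_on R n R^o U (fun x => \sum_(i <- r | P i) f i x).
Proof. by move=> sf; apply/smooth_alg/alg_sum => i; exact: alg_gen (sf i). Qed.

Lemma smooth_prod (I : Type) (r : seq I) (P : pred I) (f : I -> 'rV[R]_n -> R^o) :
  (forall i, smooth_on U (f i)) ->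
  @smooth_on R n R^o U (fun x => \prod_(i <- r | P i) f i x).
Proof. by move=> sf; apply/smooth_alg/alg_prod => i; exact: alg_gen (sf i). Qed.

Lemma smooth_inv (f : 'rV[R]_n -> R^o) : smooth_on U f ->
  (forall x, U x -> f x != 0) -> @smooth_on R n R^o U (fun x => (f x)^-1).
Proof.
move=> sf f0.
(* The derivative of 1/f is -(1/f)^2 times that of f, so adjoining 1/f to the smooth functions
   suffices. *)
pose G : set ('rV[R]_n -> R^o) := [set g | smooth_on U g \/ g = fun x => (f x)^-1].
have Gi : alg G (fun x => (f x)^-1) by apply: alg_gen; right.
apply: (@alg_smooth G) => // g [sg|->]; split=> [x Ux|v].
- exact: smooth_on_diff sg Ux.
- by apply: alg_gen; left; exact: smooth_on_derive.
- by apply: differentiableV; [exact: smooth_on_diff sf Ux|exact: f0].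
- have Gd : alg G ('D_v f) by apply: alg_gen; left; exact: smooth_on_derive.
  apply: (alg_ext (alg_mul (alg_mul (alg_cst G (-1)) (alg_mul Gi Gi)) Gd)) => x Ux.
  rewrite deriveV ?f0//=; last exact/diff_derivable/(smooth_on_diff sf).
  rewrite mulN1r -[RHS]/(- _ * _); congr (- _ * _).
  by rewrite expr2 invfM.
Qed.

End SmoothAlgebra.

Section SmoothVector.
Variables (R : realType) (n : nat).

Lemma differentiable_rV (V : normedModType R) m (f : V -> 'rV[R]_m) x :
  (forall j, differentiable (fun y => f y ord0 j : R^o) x) -> differentiable f x.
Proof.
move=> df.
have -> : f = \sum_j (fun y => f y ord0 j *: (delta_mx ord0 j : 'rV[R]_m)).
  by apply/funext => y; rewrite fct_sumE -row_sum_delta.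
by apply: differentiable_sum => j; exact: differentiableZl.
Qed.

Lemma differentiable_entry (V : normedModType R) m p (f : V -> 'M[R]_(m, p)) x i j :
  differentiable f x -> differentiable (fun y => f y i j : R^o) x.
Proof.
move=> df.
by apply: (@differentiable_comp _ _ _ _ f (fun N => N i j : R^o)) => //; exact: differentiable_coord.
Qed.

Lemma derive_entry (V : normedModType R) m p (f : V -> 'M[R]_(m, p)) x v i j :
  differentiable f x -> 'D_v f x i j = 'D_v (fun y => f y i j : R^o) x.
Proof. by move=> /diff_derivable => /(_ v) df; rewrite derive_mx// mxE. Qed.

Lemma smooth_entry (U : set 'rV[R]_n) m p (f : 'rV[R]_n -> 'M[R]_(m, p)) i j :
  open U -> smooth_on U f -> @smooth_on R n R^o U (fun y => f y i j).
Proof.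
move=> oU sf s x Ux.
have H s' y : U y -> foldr (fun v h => 'D_v h) (fun y => f y i j : R^o) s' y =
                     foldr (fun v h => 'D_v h) f s' y i j.
  elim: s' y => //= v s' IHs' y Uy.
  by rewrite (derive_eq_on oU v IHs' Uy) -derive_entry//; exact: sf.
apply: (@differentiable_eq_on _ _ _ oU R^o _ _ _ (fun y Uy => esym (H s y Uy))) => //.
by apply: differentiable_entry; exact: sf.
Qed.

Lemma smooth_rV (U : set 'rV[R]_n) m (f : 'rV[R]_n -> 'rV[R]_m) :
  open U -> (forall j, @smooth_on R n R^o U (fun y => f y ord0 j)) -> smooth_on U f.
Proof.
(* Differentiability of an iterated derivative and its entrywise formula depend on each other: [H]
   gets the former from the latter for the same list, and the induction below gets the latter for
   [v :: s] from [H] at [s]. *)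
move=> oU sf s; have H s' : (forall x, U x -> forall j, foldr (fun v h => 'D_v h) (fun y => f y ord0 j : R^o) s' x =
       foldr (fun v h => 'D_v h) f s' x ord0 j) ->
    forall x, U x -> differentiable (foldr (fun v h => 'D_v h) f s') x.
  move=> Hs x Ux; apply: differentiable_rV => j.
  by apply: (@differentiable_eq_on _ _ _ oU R^o _ _ _ (fun y Uy => Hs y Uy j)) => //; exact: sf.
suff Hs x : U x -> forall j, foldr (fun v h => 'D_v h) (fun y => f y ord0 j : R^o) s x =
       foldr (fun v h => 'D_v h) f s x ord0 j.
  exact: H.
elim: s x => //= v s IHs x Ux j.
by rewrite derive_entry; [apply: (derive_eq_on oU) => // y Uy; exact: IHs|exact: H].
Qed.

Lemma derive_sum_basis (W : normedModType R) (f : 'rV[R]_n -> W) x v :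
  differentiable f x -> 'D_v f x = \sum_j v ord0 j *: 'D_(delta_mx ord0 j) f x.
Proof.
move=> df; rewrite deriveE// {1}(row_sum_delta v) linear_sum.
by apply: eq_bigr => j _; rewrite linearZ deriveE.
Qed.

End SmoothVector.

Section SmoothComposition.
Variables (R : realType) (n : nat).

Lemma derive_chain (V : normedModType R) m (W : normedModType R)
    (f : V -> 'rV[R]_m) (g : 'rV[R]_m -> W) x v :
  differentiable f x -> differentiable g (f x) ->
  'D_v (g \o f) x = 'D_('D_v f x) g (f x).
Proof.
move=> df dg; rewrite !deriveE//; last exact: differentiable_comp.
by rewrite diff_comp.
Qed.

Lemma jacobian_chain m p q (f : 'rV[R]_m -> 'rV[R]_p) (g : 'rV[R]_p -> 'rV[R]_q) x :
  differentiable f x -> differentiable g (f x) ->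
  'J (g \o f) x = 'J f x *m 'J g (f x).
Proof.
move=> df dg; apply/row_matrixP => i; rewrite !rowE mulmxA.
by rewrite -!deriveEjacobian//; [exact: derive_chain|exact: differentiable_comp].
Qed.

Lemma smooth_comp1 m (U : set 'rV[R]_n) (V : set 'rV[R]_m)
    (f : 'rV[R]_n -> 'rV[R]_m) (g : 'rV[R]_m -> R^o) :
  open U -> open V -> smooth_on U f -> smooth_on V g ->
  (forall x, U x -> V (f x)) -> @smooth_on R n R^o U (g \o f).
Proof.
move=> oU oV sf sg fUV.
(* By the chain rule a derivative of [g \o f] is a sum of entries of ['D_v f], smooth on [U], times
   partials of [g] composed with [f]; hence the two kinds of generators. *)
pose G : set ('rV[R]_n -> R^o) :=
  [set h | smooth_on U h \/ exists2 g : 'rV[R]_m -> R^o, smooth_on V g & h = g \o f].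
apply: (@alg_smooth _ _ _ oU G); last by apply: alg_gen; right; exists g.
move=> h [sh|[{}g {}sg ->]]; split=> [x Ux|v].
- exact: smooth_on_diff sh Ux.
- by apply: alg_gen; left; exact: smooth_on_derive.
- by apply: differentiable_comp; [exact: smooth_on_diff sf Ux|exact: smooth_on_diff sg (fUV _ Ux)].
- have A j : alg U G (fun x => 'D_v f x ord0 j * 'D_(delta_mx ord0 j) g (f x)).
    apply: alg_mul; apply: alg_gen; first by left; apply: smooth_entry => //; exact: smooth_on_derive.
    by right; exists ('D_(delta_mx ord0 j) g) => //; exact: smooth_on_derive.
  apply: (alg_ext (alg_sum (index_enum _) predT A)) => x Ux /=.
  have df := smooth_on_diff sf Ux; have dg := smooth_on_diff sg (fUV _ Ux).
  by rewrite (derive_chain _ df dg) (derive_sum_basis _ dg).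
Qed.

Lemma smooth_comp m p (U : set 'rV[R]_n) (V : set 'rV[R]_m)
    (f : 'rV[R]_n -> 'rV[R]_m) (g : 'rV[R]_m -> 'rV[R]_p) :
  open U -> open V -> smooth_on U f -> smooth_on V g ->
  (forall x, U x -> V (f x)) -> smooth_on U (g \o f).
Proof.
move=> oU oV sf sg fUV; apply: smooth_rV => // j.
by apply: (smooth_comp1 (g := fun y => g y ord0 j) oU oV) => //; exact: smooth_entry.
Qed.

Definition mx_smooth (U : set 'rV[R]_n) m p (A : 'rV[R]_n -> 'M[R]_(m, p)) :=
  forall i j, @smooth_on R n R^o U (fun x => A x i j).

Lemma mx_smooth_mul (U : set 'rV[R]_n) m p q (A : 'rV[R]_n -> 'M[R]_(m, p))
    (B : 'rV[R]_n -> 'M[R]_(p, q)) : open U ->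
  mx_smooth U A -> mx_smooth U B -> mx_smooth U (fun x => A x *m B x).
Proof.
move=> oU sA sB i j; apply: (@smooth_on_ext _ _ _ oU R^o (fun x => \sum_k A x i k * B x k j)).
  by move=> x _; rewrite mxE.
by apply: smooth_sum => // k; exact: smooth_mul.
Qed.

Lemma mx_smooth_tr (U : set 'rV[R]_n) m p (A : 'rV[R]_n -> 'M[R]_(m, p)) :
  open U -> mx_smooth U A -> mx_smooth U (fun x => (A x)^T).
Proof.
move=> oU sA i j; apply: (@smooth_on_ext _ _ _ oU R^o (fun x => A x j i)) => //.
by move=> x _; rewrite mxE.
Qed.

Lemma mx_smooth_cst (U : set 'rV[R]_n) m p (A : 'M[R]_(m, p)) :
  open U -> mx_smooth U (cst A).
Proof. by move=> oU i j; exact: smooth_cst. Qed.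

Lemma smooth_det (U : set 'rV[R]_n) m (A : 'rV[R]_n -> 'M[R]_m) :
  open U -> mx_smooth U A -> @smooth_on R n R^o U (fun x => \det (A x)).
Proof.
move=> oU sA; apply: smooth_sum => // s; apply: smooth_mul => //.
  exact: smooth_cst.
by apply: smooth_prod => // i.
Qed.

Lemma mx_smooth_inv (U : set 'rV[R]_n) m (A : 'rV[R]_n -> 'M[R]_m) :
  open U -> mx_smooth U A -> (forall x, U x -> A x \in unitmx) ->
  mx_smooth U (fun x => invmx (A x)).
Proof.
move=> oU sA uA i j.
apply: (@smooth_on_ext _ _ _ oU R^o (fun x => (\det (A x))^-1 * cofactor (A x) j i)).
  by move=> x Ux; rewrite /invmx uA// !mxE.
apply: smooth_mul => //.
  by apply: smooth_inv (smooth_det oU sA) _ => // x /uA; rewrite unitmxE unitfE.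
apply: smooth_mul => //; first exact: smooth_cst.
apply: smooth_det => // a b; apply: (@smooth_on_ext _ _ _ oU R^o (fun x => A x (lift j a) (lift i b))) => //.
by move=> x _; rewrite !mxE.
Qed.

Lemma mx_smooth_jacobian (U : set 'rV[R]_n) m (f : 'rV[R]_n -> 'rV[R]_m) :
  open U -> smooth_on U f -> mx_smooth U (fun x => 'J f x).
Proof.
move=> oU sf i j.
apply: (@smooth_on_ext _ _ _ oU R^o (fun x => 'D_(delta_mx ord0 i) f x ord0 j)); last first.
  by apply: smooth_entry => //; exact: smooth_on_derive.
move=> x Ux; rewrite deriveEjacobian; last exact: smooth_on_diff sf Ux.
by rewrite -rowE mxE.
Qed.

End SmoothComposition.

(** * Mean value estimates and symmetry of second derivatives *)

Section MeanValue.
Variable R : realType.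

Lemma mx_norm_leP m n (A : 'M[R]_(m, n)) (C : R) : 0 <= C ->
  (`|A| <= C) <-> (forall i j, `|A i j| <= C).
Proof.
move=> C0; rewrite [X in X <= _]/Num.Def.normr/= mx_normrE; split.
  by move=> H i j; apply: le_trans H; exact: (le_bigmax _ (fun ij => `|A ij.1 ij.2|) (i, j)).
by move=> H; apply: bigmax_le.
Qed.

Lemma entry_norm_le m n (A : 'M[R]_(m, n)) i j : `|A i j| <= `|A|.
Proof. exact: (mx_norm_leP A (normr_ge0 A)).1. Qed.

Lemma is_derive_entry (V : normedModType R) m n (f : V -> 'M[R]_(m, n)) x v df i j :
  is_derive x v f df -> is_derive x v (fun t => f t i j : R) (df i j).
Proof.
move=> [fx fE]; apply: DeriveDef; first exact: (derivable_mxP f x v).1.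
by rewrite -fE derive_mx// mxE.
Qed.

Lemma mean_value_ineq m n (f df : R -> 'M[R]_(m, n)) (a b C : R) : a <= b -> 0 <= C ->
  (forall t, a <= t <= b -> is_derive t 1 f (df t)) ->
  (forall t, a <= t <= b -> `|df t| <= C) ->
  `|f b - f a| <= C * (b - a).
Proof.
move=> ab C0 fd fC; have ba : 0 <= b - a by rewrite subr_ge0.
apply/mx_norm_leP => [|i j]; first exact: mulr_ge0.
pose g t := f t i j : R.
have gd t : a <= t <= b -> is_derive t 1 g (df t i j).
  by move=> tab; apply: is_derive_entry; exact: fd.
have cg : {within `[a, b], continuous g}.
  apply: derivable_within_continuous => t; rewrite in_itv/= => tab.
  by have [] := gd t tab.
have gd' t : t \in `]a, b[ -> is_derive t 1 g (df t i j).
  by rewrite in_itv/= => /andP[at_ tb]; apply: gd; rewrite !ltW.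
have [c cab gE] := MVT_segment ab gd' cg.
rewrite !mxE -/(g a) -/(g b) gE normrM (ger0_norm ba) ler_wpM2r//.
by rewrite (le_trans (entry_norm_le _ _ _))// fC// -in_itv.
Qed.

Lemma is_derive_line n (W : normedModType R) (f : 'rV[R]_n -> W) (x v : 'rV[R]_n) (t : R) :
  differentiable f (x + t *: v) ->
  is_derive t 1 (fun s : R => f (x + s *: v)) ('D_v f (x + t *: v)).
Proof.
move=> /diff_derivable => /(_ v) df.
have gE : (fun h : R => h^-1 *: (f (x + (h *: 1 + t) *: v) - f (x + t *: v))) =
          (fun h => h^-1 *: (f (h *: v + (x + t *: v)) - f (x + t *: v))).
  apply/funext => h; congr (_ *: (f _ - _)).
  by rewrite [h%:A]mulr1 scalerDl addrCA.
by apply: DeriveDef; rewrite /derivable /derive gE.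
Qed.

Lemma mean_value_line n (f : 'rV[R]_n -> R^o) (x v : 'rV[R]_n) (t : R) : 0 < t ->
  (forall s, 0 <= s <= t -> differentiable f (x + s *: v)) ->
  exists2 s, 0 < s < t & (f (x + t *: v) : R) - f x = t * 'D_v f (x + s *: v).
Proof.
move=> t0 df.
pose g s : R := f (x + s *: v).
have gd s : 0 <= s <= t -> is_derive s 1 g ('D_v f (x + s *: v)).
  by move=> st; apply: is_derive_line; exact: df.
have cg : {within `[0, t], continuous g}.
  apply: derivable_within_continuous => s; rewrite in_itv/= => st.
  by have [] := gd s st.
have gd' s : s \in `]0, t[ -> is_derive s 1 g ('D_v f (x + s *: v)).
  by rewrite in_itv/= => /andP[s0 st]; apply: gd; rewrite !ltW.
have [s sab gE] := MVT t0 gd' cg.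
exists s; first by move: sab; rewrite in_itv.
by rewrite mulrC -[t in RHS]subr0 -gE /g scale0r addr0.
Qed.

(** Mean value theorem twice: in direction [u] for the increment y |-> f(y + t v) - f(y), then in
    direction [v] for ['D_u f]. *)
Lemma second_difference n (U : set 'rV[R]_n) (f : 'rV[R]_n -> R^o) (x u v : 'rV[R]_n) (t : R) :
  open U -> smooth_on U f -> 0 < t ->
  (forall a b, 0 <= a <= t -> 0 <= b <= t -> U (x + a *: u + b *: v)) ->
  exists a b, [/\ 0 < a < t, 0 < b < t &
    (f (x + t *: u + t *: v) : R) - f (x + t *: u) - ((f (x + t *: v) : R) - f x) =
      t * (t * 'D_v ('D_u f) (x + a *: u + b *: v))].
Proof.
move=> oU sf t0 Uab.
have t00 : 0 <= (0 : R) <= t by rewrite lexx ltW.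
have tt : 0 <= t <= t by rewrite lexx ltW.
have dfa b a : 0 <= a <= t -> 0 <= b <= t -> differentiable f (x + a *: u + b *: v).
  by move=> ? ?; apply: (smooth_on_diff sf); exact: Uab.
pose F y : R^o := (f (y + t *: v) : R) - f y.
have dft a : 0 <= a <= t -> differentiable (fun y => f (y + t *: v)) (x + a *: u).
  move=> at_; apply: (@differentiable_comp _ _ _ _ (fun y => y + t *: v) f) => //.
  exact: dfa.
have df0 a : 0 <= a <= t -> differentiable f (x + a *: u).
  by move=> at_; have := dfa 0 a at_ t00; rewrite scale0r addr0.
have [|a a0t FE] := @mean_value_line _ F x u t t0.
  by move=> a at_; exact: differentiableB (dft a at_) (df0 a at_).
have at_ : 0 <= a <= t by case/andP: a0t => *; rewrite !ltW.
have [|b b0t DE] := @mean_value_line _ ('D_u f) (x + a *: u) v t t0.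
  by move=> b bt; apply: (smooth_on_diff (smooth_on_derive u sf)); exact: Uab.
exists a, b; split=> //; rewrite -DE.
rewrite -[LHS]/((F (x + t *: u) : R) - F x).
rewrite FE; congr (_ * _).
have E1 : 'D_u (fun y => f (y + t *: v)) (x + a *: u) = 'D_u f (x + a *: u + t *: v).
  have /= := @derive_chain R _ n R^o (fun y => y + t *: v) f (x + a *: u) u.
  move=> ->; [|by []|exact: dfa].
  by rewrite deriveD// derive_id derive_cst addr0.
rewrite -[F]/((fun y => f (y + t *: v)) - f) deriveB; [|exact/diff_derivable/dft|exact/diff_derivable/df0].
by rewrite E1.
Qed.

(** Exchanging the two directions swaps the middle values [q] and [r] and leaves the second
    difference unchanged. *)
Lemma second_difference_sym (t A B p q r s : R) : t != 0 ->
  p - q - (r - s) = t * (t * A) -> p - r - (q - s) = t * (t * B) -> A = B.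
Proof.
move=> t0 EA EB; apply: (mulfI t0); apply: (mulfI t0).
by rewrite -EA -EB !opprD !opprK addrACA.
Qed.

Lemma dist_le_half (a b c e : R) :
  `|a - b| < e / 2 -> `|c - b| < e / 2 -> `|a - c| <= e.
Proof.
move=> ab cb; rewrite -(subrKA b) (splitr e) (le_trans (ler_normD _ _))// lerD ?ltW//.
by rewrite distrC.
Qed.

(** The second difference over a small parallelogram is t^2 times either mixed derivative, each
    taken at its own point; continuity brings both values close to those at [x]. *)
Theorem schwarz n (U : set 'rV[R]_n) (f : 'rV[R]_n -> R^o) (x u v : 'rV[R]_n) :
  open U -> smooth_on U f -> U x -> 'D_u ('D_v f) x = 'D_v ('D_u f) x.
Proof.
move=> oU sf Ux; apply/eqP; rewrite -subr_eq0 -normr_eq0 eq_le normr_ge0 andbT.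
apply/ler_addgt0Pl => e e0; rewrite addr0.
have cont a b : {for x, continuous ('D_a ('D_b f))}.
  apply: differentiable_continuous.
  by apply: (smooth_on_diff _ Ux); do 2!apply: smooth_on_derive.
have e2 : 0 < e / 2 by rewrite divr_gt0.
have near2 a b : \forall y \near x, `|'D_a ('D_b f) x - 'D_a ('D_b f) y| < e / 2.
  by have /cvgrPdist_lt/(_ _ e2) := cont a b.
have : nbhs x [set y | U y /\ (`|'D_u ('D_v f) x - 'D_u ('D_v f) y| < e / 2 /\
    `|'D_v ('D_u f) x - 'D_v ('D_u f) y| < e / 2)].
  exact: filterI (open_near oU Ux) (filterI (near2 u v) (near2 v u)).
move=> /nbhs_ballP[r /= r0 xr].
(* The parallelogram with sides [t *: u] and [t *: v] then lies in the ball of radius [r]; the 1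
   keeps the denominator positive when both directions vanish. *)
pose t := r / (2 * (`|u| + `|v| + 1)).
have k0 : 0 < `|u| + `|v| + 1 by rewrite ltr_wpDl// addr_ge0.
have t0 : 0 < t by rewrite divr_gt0// mulr_gt0.
have near_ab a b : 0 <= a <= t -> 0 <= b <= t -> ball x r (x + a *: u + b *: v).
  move=> /andP[a0 at_] /andP[b0 bt]; rewrite -ball_normE /= -addrA opprD addNKr normrN.
  rewrite (le_lt_trans (ler_normD _ _))// !normrZ !ger0_norm//.
  apply: (@le_lt_trans _ _ (t * (`|u| + `|v| + 1))).
    rewrite !mulrDr mulr1; apply: (@le_trans _ _ (t * `|u| + t * `|v|)).
      by apply: lerD; rewrite ler_wpM2r.
    by rewrite lerDl ltW.
  by rewrite /t invfM -!mulrA mulVf ?gt_eqF// mulr1 ltr_pdivrMr// ltr_pMr// ltr1n.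
have inU w z : (forall a b, 0 <= a <= t -> 0 <= b <= t -> ball x r (x + a *: w + b *: z)) ->
  forall a b, 0 <= a <= t -> 0 <= b <= t -> U (x + a *: w + b *: z).
  by move=> H a b at_ bt; have [? _] := xr _ (H a b at_ bt).
have near_ba a b : 0 <= a <= t -> 0 <= b <= t -> ball x r (x + a *: v + b *: u).
  by move=> at_ bt; rewrite addrAC; exact: near_ab.
have [a [b [a0 b0 E1]]] := second_difference oU sf t0 (inU _ _ near_ab).
have [a' [b' [a'0 b'0 E2]]] := second_difference oU sf t0 (inU _ _ near_ba).
have ltle c : 0 < c < t -> 0 <= c <= t by case/andP=> *; rewrite !ltW.
have [_ [_ X1]] := xr _ (near_ab _ _ (ltle _ a0) (ltle _ b0)).
have [_ [X2 _]] := xr _ (near_ba _ _ (ltle _ a'0) (ltle _ b'0)).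
rewrite (addrAC x (t *: v)) in E2.
have EE := second_difference_sym (lt0r_neq0 t0) E1 E2.
rewrite -EE in X2.
exact: dist_le_half X2 X1.
Qed.

End MeanValue.

(** * Ordinary differential equations *)

Section Primitive.
Variable R : realType.

(* Integrating from [-1] makes the derivative two-sided on all of [0, 1]. *)
Lemma scalar_primitive (f : R -> R) : continuous f ->
  exists2 F : R -> R, F 0 = 0 & forall t : R, 0 <= t <= 1 -> is_derive t 1 F (f t).
Proof.
move=> cf.
pose I (x : R) : R := (\int[lebesgue_measure]_(t in [set` `[(-1) : R, x]]) (f t))%R.
have If (x : R) : 0 <= x <= 1 -> is_derive x 1 I (f x).
  move=> /andP[x0 x1].
  have x2 : x < 2 by rewrite (le_lt_trans x1)// ltr1n.
  have intf : lebesgue_measure.-integrable `[(-1) : R, 2] (EFin \o f).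
    apply: continuous_compact_integrable; first exact: segment_compact.
    exact: continuous_subspaceT.
  have xN1 : -1 < x by rewrite (lt_le_trans _ x0)// ltrN10.
  have [dI IE] := continuous_FTC1_closed x2 intf xN1 (cf x).
  by apply: DeriveDef; rewrite -?derive1E.
exists (fun x => I x - I 0); first by rewrite subrr.
move=> t /If It; rewrite -[f t]subr0.
exact: is_deriveB.
Qed.

Lemma primitive n (f : R -> 'rV[R]_n) : continuous f ->
  exists2 F : R -> 'rV[R]_n, F 0 = 0 &
    forall t : R, 0 <= t <= 1 -> is_derive t 1 F (f t).
Proof.
move=> cf.
have H j : exists F : R -> R, F 0 = 0 /\ forall t : R, 0 <= t <= 1 -> is_derive t 1 F (f t ord0 j).
  have [|F F0 dF] := @scalar_primitive (fun t => f t ord0 j); last by exists F.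
  move=> t; apply: (@continuous_comp _ _ _ f (fun v : 'rV[R]_n => v ord0 j)); first exact: cf.
  exact: coord_continuous.
have [F FP] := choice H.
exists (fun t => \row_j F j t).
  by apply/rowP => j; rewrite !mxE; case: (FP j).
move=> t t01; have dF : derivable (fun t => \row_j F j t) t 1.
  apply/derivable_mxP => i j.
  rewrite (_ : (fun x => _) = F j); first by case: (FP j) => _ /(_ t t01)[].
  by apply/funext => x; rewrite mxE.
apply: DeriveDef => //; rewrite derive_mx//; apply/rowP => j; rewrite mxE.
rewrite (_ : (fun x => _) = F j); first by case: (FP j) => _ /(_ t t01)[].
by apply/funext => x; rewrite mxE.
Qed.

End Primitive.

Section ODE.
Variable R : realType.

Lemma half_powers_small (c : R) (a : R) : (forall k, a <= c / 2 ^+ k) -> a <= 0.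
Proof.
move=> H.
have cv : (fun k => c / 2 ^+ k : R) @ \oo --> (0 : R).
  rewrite (_ : (fun k => _) = geometric c (2^-1)).
    by apply: cvg_geometric; rewrite ger0_norm ?invr_ge0// invf_lt1 ?ltr1n.
  by apply/funext => k /=; rewrite exprVn.
apply: (@closed_cvg _ _ \oo eventually_filter _ [set x | a <= x] (@closed_ge _ a) _ _ cv).
by apply: nearW => k; exact: H.
Qed.

Lemma geometric_cauchy n (a : nat -> 'rV[R]_n) (c : R) : 0 <= c ->
  (forall k, `|a k.+1 - a k| <= c / 2 ^+ k.+1) ->
  exists l, forall k, `|l - a k| <= c / 2 ^+ k.
Proof.
move=> c0 H.
(* The factor 1 - 2^-m, a partial sum of the geometric series, is what closes the induction on
   [m]. *)
have T k m : `|a (k + m)%N - a k| <= c / 2 ^+ k * (1 - 2^-1 ^+ m).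
  elim: m => [|m IHm]; first by rewrite addn0 subrr normr0 expr0 subrr mulr0.
  rewrite addnS -(subrKA (a (k + m)%N)) (le_trans (ler_normD _ _))//.
  apply: (le_trans (lerD (H _) IHm)).
  rewrite le_eqVlt; apply/orP; left; apply/eqP.
  have -> : c / 2 ^+ (k + m).+1 = c / 2 ^+ k * (2^-1 * 2^-1 ^+ m).
    by rewrite exprVn -invfM -exprS -mulrA -invfM -exprD addnS.
  by rewrite exprS; set q := _ ^+ m; set p := c / _; field.
have T' k m : `|a (k + m)%N - a k| <= c / 2 ^+ k.
  apply: le_trans (T k m) _; rewrite ler_piMr//; first by rewrite divr_ge0// exprn_ge0.
  by rewrite gerBl exprn_ge0// invr_ge0.
have cva : cvgn a.
  apply/cauchy_cvgP/cauchy_exP => e e0.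
  have [k ck] : exists k, c / 2 ^+ k < e.
    apply: contrapT => /forallNP N; suff : e <= 0 by rewrite leNgt e0.
    by apply: (@half_powers_small c) => k; rewrite leNgt; apply/negP/N.
  exists (a k), k => // m /= km; rewrite -ball_normE /=.
  by rewrite distrC (le_lt_trans _ ck)// -(subnKC km).
exists (limn a) => k.
have cvn : (fun m => `|a m - a k|) @ \oo --> `|limn a - a k|.
  by apply: cvg_norm; apply: cvgB => //; exact: cvg_cst.
apply: (@closed_cvg _ _ \oo eventually_filter _ [set x | x <= c / 2 ^+ k] (@closed_le _ _) _ _ cvn).
by exists k => // m /= km; rewrite -(subnKC km).
Qed.

(** Retraction of time onto [0, 1]: Picard iterates stay continuous and confined to the ball at all
    real times, although their primitives are controlled on [0, 1] only. *)
Definition clamp01 (t : R) : R := Num.max 0 (Num.min 1 t).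

Lemma clamp01_itv t : 0 <= clamp01 t <= 1.
Proof. by rewrite /clamp01 le_max lexx ge_max ler01 ge_min lexx. Qed.

Lemma clamp01_id t : 0 <= t <= 1 -> clamp01 t = t.
Proof. by case/andP=> t0 t1; rewrite /clamp01 min_r// max_r. Qed.

Lemma continuous_clamp01 : continuous clamp01.
Proof.
move=> t.
have H : {for t, continuous ((cst 0 : R -> R^o) \max ((cst 1 : R -> R^o) \min (id : R -> R^o)))}.
  apply: continuous_max; first exact: cvg_cst.
  by apply: continuous_min; [exact: cvg_cst|exact: cvg_id].
exact: H.
Qed.

(** The bounds make the integral operator preserve the curves in the ball and contract by 1/2 over
    all of [0, 1], so the time interval is not shortened; smallness will come from the parameter [s]
    of the field [s *m Q]. *)
Lemma picard n (G : 'rV[R]_n -> 'rV[R]_n) (y0 : 'rV[R]_n) (rho : R) : 0 <= rho ->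
  (forall y, `|y - y0| <= rho -> `|G y| <= rho) ->
  (forall y z, `|y - y0| <= rho -> `|z - y0| <= rho -> `|G y - G z| <= `|y - z| / 2) ->
  exists u : R -> 'rV[R]_n, u 0 = y0 /\
    forall t : R, 0 <= t <= 1 -> `|u t - y0| <= rho /\ is_derive t 1 u (G (u t)).
Proof.
move=> rho0 Gb GL.
pose I (w : R -> 'rV[R]_n) := continuous w /\ forall t, `|w t - y0| <= rho.
have cG w : I w -> continuous (G \o w).
  move=> [cw wb] t; apply/cvgrPdist_lt => e e0.
  have /cvgrPdist_lt/(_ e e0) := cw t.
  apply: filterS => s ws; rewrite (le_lt_trans (GL _ _ (wb _) (wb _)))//.
  by rewrite (le_lt_trans _ ws)// ler_pdivrMr// ler_peMr// ler1n.
(* [choice] needs a total family, so inadmissible curves receive the zero function. *)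
have prim w : exists F : R -> 'rV[R]_n, I w -> F 0 = 0 /\
    forall t : R, 0 <= t <= 1 -> is_derive t 1 F (G (w t)).
  have [Iw|nIw] := pselect (I w); last by exists (cst 0).
  by have [F F0 dF] := primitive (cG w Iw); exists F.
have [P PP] := choice prim.
pose T w t := y0 + P w (clamp01 t).
have PB w w' (M : R) : I w -> I w' -> 0 <= M -> (forall t, `|w t - w' t| <= M) ->
    forall t : R, 0 <= t <= 1 -> `|P w t - P w' t| <= M / 2.
  move=> Iw Iw' M0 wM t /andP[t0 t1].
  have [Pw0 dPw] := PP w Iw; have [Pw'0 dPw'] := PP w' Iw'.
  have := @mean_value_ineq R _ _ (fun t => P w t - P w' t)
     (fun t => G (w t) - G (w' t)) 0 t (M / 2) t0.
  rewrite /= Pw0 Pw'0 !subr0 => H.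
  apply: le_trans (H _ _ _) _.
  - exact: (divr_ge0 M0 (ler0n _ 2)).
  - move=> s /andP[s0 st].
    have s01 : 0 <= s <= 1 by rewrite s0 (le_trans st).
    by have ? := dPw s s01; have ? := dPw' s s01; exact: is_deriveB.
  - move=> s _; apply: le_trans (GL _ _ (Iw.2 s) (Iw'.2 s)) _.
    by apply: ler_wpM2r; [rewrite invr_ge0|exact: wM].
  - by rewrite ler_piMr// divr_ge0.
have TD w w' t : T w t - T w' t = P w (clamp01 t) - P w' (clamp01 t).
  by rewrite /T opprD addrACA subrr add0r.
have PN w : I w -> forall t : R, 0 <= t <= 1 -> `|P w t| <= rho.
  move=> Iw t /andP[t0 t1]; have [Pw0 dPw] := PP w Iw.
  have := @mean_value_ineq R _ _ (P w) (G \o w) 0 t rho t0 rho0.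
  rewrite Pw0 !subr0 => H; apply: le_trans (H _ _) _.
  - by move=> s /andP[s0 st]; apply: dPw; rewrite s0 (le_trans st).
  - by move=> s _; apply: Gb; exact: Iw.2.
  - by rewrite ler_piMr.
have IT w : I w -> I (T w).
  move=> Iw; have [_ dPw] := PP w Iw; split=> t; last first.
    by rewrite /T addrC addKr PN// clamp01_itv.
  apply: continuousD; first exact: cvg_cst.
  apply: (@continuous_comp _ _ _ clamp01 (P w)); first exact: continuous_clamp01.
  apply: differentiable_continuous; apply/derivable1_diffP.
  by have [] := dPw _ (clamp01_itv t).
pose w k := iter k T (cst y0).
have I0 : I (cst y0) by split=> t; [exact: cvg_cst|rewrite subrr normr0].
have Iw k : I (w k) by elim: k => //= k; exact: IT.
(* The first iterate moves by at most [rho], which is (rho + rho) / 2^1. *)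
have step k t : `|w k.+1 t - w k t| <= (rho + rho) / 2 ^+ k.+1.
  elim: k t => [|k IHk] t.
    rewrite expr1 mulrDl -splitr.
    by have := (IT _ I0).2 t.
  rewrite -[X in `|X|]/(T (w k.+1) t - T (w k) t) TD [in leRHS]exprSr invfM mulrA PB ?clamp01_itv// divr_ge0// ?exprn_ge0//.
  by rewrite addr_ge0.
have rr : 0 <= rho + rho by rewrite addr_ge0.
have [l lP] := choice (fun t => geometric_cauchy rr (step^~ t)).
have lb t : `|l t - y0| <= rho.
  rewrite -subr_le0; apply: (@half_powers_small (rho + rho)) => k.
  rewrite lerBlDr -(subrKA (w k t)) (le_trans (ler_normD _ _))// lerD ?lP//.
  exact: (Iw k).2.
have cl : continuous l.
  move=> t; apply/cvgrPdist_lt => e e0.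
  have [k ck] : exists k, (rho + rho) / 2 ^+ k < e / 3.
    apply: contrapT => /forallNP N; suff : e / 3 <= 0 by rewrite leNgt divr_gt0.
    by apply: (@half_powers_small (rho + rho)) => k; rewrite leNgt; apply/negP/N.
  have e3 : 0 < e / 3 by rewrite divr_gt0.
  have /cvgrPdist_lt/(_ _ e3) := (Iw k).1 t.
  apply: filterS => s ws.
  have -> : l t - l s = (l t - w k t) + (w k t - w k s) - (l s - w k s).
    by rewrite opprB addrA addrA !subrK.
  have -> : e = e / 3 + e / 3 + e / 3 by field.
  rewrite (le_lt_trans (ler_normB _ _))// ltrD//; last by rewrite (le_lt_trans (lP _ _)).
  by rewrite (le_lt_trans (ler_normD _ _))// ltrD// (le_lt_trans (lP _ _)).
have Il : I l by [].
have Tl t : T l t = l t.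
  apply/eqP; rewrite -subr_eq0 -normr_eq0 eq_le normr_ge0 andbT.
  apply: (@half_powers_small (rho + rho)) => k.
  rewrite -(subrKA (w k.+1 t)) (le_trans (ler_normD _ _))//.
  have -> : (rho + rho) / 2 ^+ k = (rho + rho) / 2 ^+ k / 2 + (rho + rho) / 2 ^+ k.+1.
    by rewrite exprSr invfM mulrA -splitr.
  rewrite lerD//; last by rewrite distrC lP.
  rewrite -[X in `|X|]/(T l t - T (w k) t) TD PB ?clamp01_itv// divr_ge0// ?exprn_ge0//.
(* [l] is constant outside [0, 1] and may lack a two-sided derivative at the endpoints; [y0 + P l t]
   agrees with it on [0, 1] and has one. *)
exists (fun t => y0 + P l t); have [P0 dP] := PP l Il.
have PE t : 0 <= t <= 1 -> y0 + P l t = l t.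
  by move=> t01; rewrite -Tl /T clamp01_id.
split; first by rewrite P0 addr0.
move=> t t01; rewrite PE//; split=> //.
by have ? := dP t t01; rewrite -[G _]add0r; exact: is_deriveD.
Qed.

(** At a time where |e| attains its maximum m on [0, 1], the mean value inequality gives m <= m / 2
    + c; the constant 1/2 spares the exponential. *)
Lemma gronwall_half n (e de : R -> 'rV[R]_n) (c : R) : e 0 = 0 ->
  (forall t : R, 0 <= t <= 1 -> is_derive t 1 e (de t)) ->
  (forall t : R, 0 <= t <= 1 -> `|de t| <= `|e t| / 2 + c) ->
  `|e 1| <= c + c.
Proof.
move=> e00 eD eB.
have ce : {within `[0, 1], continuous (fun t => `|e t| : R)}.
  apply: continuous_in_subspaceT => t /[1!inE]/= t01.
  apply: (@continuous_comp _ _ _ e (fun v => `|v|)); last exact: norm_continuous.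
  apply: differentiable_continuous; apply/derivable1_diffP.
  by have [] := eD t t01.
have [x x01 xmax] := EVT_max (@ler01 R) ce.
have x01' : 0 <= x <= 1 by move: x01; rewrite in_itv.
have M0 : 0 <= `|e x| / 2 + c.
  by have := le_trans (normr_ge0 _) (eB x x01').
have M t : 0 <= t <= 1 -> `|e t| <= `|e x| / 2 + c.
  move=> /andP[t0 t1].
  have := @mean_value_ineq R _ _ e de 0 t (`|e x| / 2 + c) t0 M0.
  rewrite e00 !subr0 => H; apply: le_trans (H _ _) _.
  - by move=> s /andP[s0 st]; apply: eD; rewrite s0 (le_trans st).
  - move=> s /andP[s0 st]; have s01 : 0 <= s <= 1 by rewrite s0 (le_trans st).
    apply: le_trans (eB s s01) _; apply: lerD => //.
    by apply: ler_wpM2r; [rewrite invr_ge0|apply: xmax; rewrite in_itv].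
  - by rewrite ler_piMr.
have := M x x01'; rewrite -lerBlDl.
have -> : `|e x| - `|e x| / 2 = `|e x| / 2 by rewrite {1}[`|e x|]splitr addrK.
rewrite ler_pdivrMr// mulr_natr mulr2n => xc.
by rewrite (le_trans _ xc)// xmax// in_itv/= ler01 lexx.
Qed.

End ODE.

(** * The local Frobenius theorem for commuting frames *)

Section Estimates.
Variables (R : realType) (n : nat) (U : set 'rV[R]_n) (x0 : 'rV[R]_n).
Hypotheses (oU : open U) (Ux0 : U x0).

Lemma near_norm_le (g : 'rV[R]_n -> R^o) : {for x0, continuous g} ->
  \forall y \near x0, `|g y : R| <= `|g x0 : R| + 1.
Proof.
move=> cg; have /cvgrPdist_lt/(_ _ ltr01) := cg.
apply: filterS => y gy; rewrite -lerBlDl.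
by apply: (le_trans (lerB_dist _ _)); rewrite ltW// distrC.
Qed.

Lemma ler_norm_sum_mul (I : finType) (c d : I -> R) (a : R) (b : I -> R) : 0 <= a ->
  (forall i, `|c i| <= a) -> (forall i, `|d i| <= b i) ->
  `|\sum_i c i * d i| <= a * \sum_i b i.
Proof.
move=> a0 ca db; rewrite mulr_sumr (le_trans (ler_norm_sum _ _ _))//.
by apply: ler_sum => i _; rewrite normrM ler_pM.
Qed.

Lemma derive_locally_bounded (f : 'rV[R]_n -> R^o) : smooth_on U f ->
  exists2 K : R, 0 <= K & \forall y \near x0, forall v, `|'D_v f y : R| <= `|v| * K.
Proof.
move=> sf; pose d j := 'D_(delta_mx ord0 j) f.
exists (\sum_j (`|d j x0 : R| + 1)); first by apply: sumr_ge0 => j _; rewrite addr_ge0.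
have H j : \forall y \near x0, `|d j y : R| <= `|d j x0 : R| + 1.
  apply: near_norm_le; apply: differentiable_continuous.
  by apply: smooth_on_diff Ux0; exact: smooth_on_derive.
have H' : \forall y \near x0, forall j, `|d j y : R| <= `|d j x0 : R| + 1.
  exact: (filter_forall (nbhs_filter x0) H).
have : nbhs x0 [set y | U y /\ forall j, `|d j y : R| <= `|d j x0 : R| + 1].
  exact: filterI (open_near oU Ux0) H'.
apply: filterS => y [Uy dy] v.
rewrite (derive_sum_basis _ (smooth_on_diff sf Uy)).
apply: (@ler_norm_sum_mul _ (fun j => v ord0 j) (fun j => d j y)) => // j.
exact: entry_norm_le.
Qed.

Lemma ball_segment (rho : R) (y z : 'rV[R]_n) (t : R) : 0 <= t <= 1 ->
  `|y - x0| < rho -> `|z - x0| < rho -> `|y + t *: (z - y) - x0| < rho.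
Proof.
move=> /andP[t0 t1] yr zr.
have -> : y + t *: (z - y) - x0 = (1 - t) *: (y - x0) + t *: (z - x0).
  by apply/rowP => j; rewrite !mxE; ring.
rewrite (le_lt_trans (ler_normD _ _))// !normrZ (ger0_norm t0) ger0_norm ?subr_ge0//.
have [-> | tn0] := eqVneq t 0; first by rewrite mul0r addr0 subr0 mul1r.
have -> : rho = (1 - t) * rho + t * rho by ring.
apply: ler_ltD; first by rewrite ler_wpM2l ?subr_ge0// ltW.
by rewrite ltr_pM2l// lt0r tn0.
Qed.

Lemma derive_bound_lipschitz (f : 'rV[R]_n -> R^o) (K rho : R) :
  (forall y, `|y - x0| < rho -> differentiable f y /\ forall v, `|'D_v f y : R| <= `|v| * K) ->
  forall y z, `|y - x0| < rho -> `|z - x0| < rho ->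
    `|(f z : R) - f y| <= `|z - y| * K /\
    exists2 t : R, 0 < t < 1 & (f z : R) - f y = 'D_(z - y) f (y + t *: (z - y)).
Proof.
move=> fK y z yr zr.
have [|t t01 E] := @mean_value_line R n f y (z - y) 1 ltr01.
  by move=> s s01; have [] := fK _ (ball_segment s01 yr zr).
rewrite scale1r (addrC y) subrK mul1r in E.
have t01' : 0 <= t <= 1 by case/andP: t01 => *; rewrite !ltW.
split; last by exists t.
by rewrite E; have [_] := fK _ (ball_segment t01' yr zr); apply.
Qed.

(** The mean value theorem turns the quadratic remainder into a difference of first derivatives at
    two points, and the partials are Lipschitz because their own derivatives are bounded. [K] is the
    sum of the separate bounds. *)
Lemma smooth_estimates (f : 'rV[R]_n -> R^o) : smooth_on U f ->
  exists K rho : R, [/\ 0 <= K, 0 < rho &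
    forall y, `|y - x0| < rho ->
    [/\ U y, `|f y : R| <= K, forall v, `|'D_v f y : R| <= `|v| * K &
      forall z, `|z - x0| < rho -> `|(f z : R) - f y| <= `|z - y| * K /\
        `|(f z : R) - f y - 'D_(z - y) f y| <= `|z - y| ^+ 2 * K]].
Proof.
move=> sf; pose d j := 'D_(delta_mx ord0 j) f.
have sd j : smooth_on U (d j) by exact: smooth_on_derive.
have [K1 K10 H1] := derive_locally_bounded sf.
have HK j : exists K : R, 0 <= K /\ \forall y \near x0, forall v, `|'D_v (d j) y : R| <= `|v| * K.
  by have [K] := derive_locally_bounded (sd j); exists K.
have [K2 HK2] := choice HK.
have H2 : \forall y \near x0, forall j v, `|'D_v (d j) y : R| <= `|v| * K2 j.
  by apply: (filter_forall (nbhs_filter x0)) => j; have [] := HK2 j.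
have H0 : \forall y \near x0, `|f y : R| <= `|f x0 : R| + 1.
  by apply: near_norm_le; apply: differentiable_continuous; exact: smooth_on_diff sf Ux0.
have S2 : 0 <= \sum_j K2 j by apply: sumr_ge0 => j _; have [] := HK2 j.
have C0 : 0 <= `|f x0 : R| + 1 by rewrite addr_ge0.
pose K := `|f x0 : R| + 1 + K1 + \sum_j K2 j.
have : nbhs x0 [set y | U y /\ (`|f y : R| <= `|f x0 : R| + 1 /\
    ((forall v, `|'D_v f y : R| <= `|v| * K1) /\ (forall j v, `|'D_v (d j) y : R| <= `|v| * K2 j)))].
  exact: filterI (open_near oU Ux0) (filterI H0 (filterI H1 H2)).
move=> /nbhs_ballP[rho /= rho0 xr].
have xrho y : `|y - x0| < rho -> U y /\ (`|f y : R| <= `|f x0 : R| + 1 /\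
    ((forall v, `|'D_v f y : R| <= `|v| * K1) /\ (forall j v, `|'D_v (d j) y : R| <= `|v| * K2 j))).
  by move=> yr; apply: xr; rewrite -ball_normE/= distrC.
have K1K : K1 <= K by rewrite /K -addrA addrCA lerDl addr_ge0.
have K2K : \sum_j K2 j <= K by rewrite /K lerDr addr_ge0.
exists K, rho; split=> //; first by rewrite !addr_ge0.
move=> y yr; have [Uy [fy [Dy D2y]]] := xrho y yr.
have L1 z : `|z - x0| < rho -> differentiable f z /\ forall v, `|'D_v f z : R| <= `|v| * K1.
  by move=> /xrho[Uz [_ [? _]]]; split=> //; exact: smooth_on_diff sf Uz.
have L2 j z : `|z - x0| < rho -> differentiable (d j) z /\ forall v, `|'D_v (d j) z : R| <= `|v| * K2 j.
  move=> /xrho[Uz [_ [_ H]]]; split; last exact: H.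
  exact: smooth_on_diff (sd j) Uz.
split=> //.
- by rewrite (le_trans fy)// /K -addrA lerDl addr_ge0.
- by move=> v; rewrite (le_trans (Dy v))// ler_wpM2l.
move=> z zr; have [Lz [t t01 E]] := derive_bound_lipschitz L1 yr zr; split.
  by rewrite (le_trans Lz)// ler_wpM2l.
rewrite E; set w := z - y; set xi := y + t *: w.
have t01' : 0 <= t <= 1 by case/andP: t01 => *; rewrite !ltW.
have xir := ball_segment t01' yr zr.
have [Uxi _] := xrho _ xir.
have -> : ('D_w f xi : R) - 'D_w f y = \sum_j w ord0 j * ((d j xi : R) - d j y).
  rewrite [X in X - _](derive_sum_basis _ (smooth_on_diff sf Uxi)).
  rewrite [X in _ - X](derive_sum_basis _ (smooth_on_diff sf Uy)).
  rewrite -[LHS]/((\sum_j w ord0 j * (d j xi : R)) - (\sum_j w ord0 j * (d j y : R))).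
  by rewrite -sumrB; apply: eq_bigr => j _; rewrite mulrBr.
rewrite (le_trans (ler_norm_sum_mul (normr_ge0 w) _ (b := fun j => `|w| * K2 j) _))//.
- by move=> j; exact: entry_norm_le.
- move=> j; have [Lj _] := derive_bound_lipschitz (L2 j) yr xir.
  rewrite (le_trans Lj)//; have [Kj _] := HK2 j.
  rewrite ler_wpM2r// /xi addrC addKr normrZ; case/andP: t01' => t0 t1.
  by rewrite ger0_norm// ler_piMl.
by rewrite -mulr_sumr mulrA -expr2 ler_wpM2l// exprn_ge0.
Qed.

End Estimates.

(* Locked: unfolding it during unification exposes limits and diverges. *)
HB.lock Definition mx_derive (R : realType) n k p (Q : 'rV[R]_n -> 'M[R]_(k, p))
    (y v : 'rV[R]_n) : 'M[R]_(k, p) :=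
  \matrix_(a, j) 'D_v (fun z => Q z a j : R^o) y.

Lemma mx_deriveE (R : realType) n k p (Q : 'rV[R]_n -> 'M[R]_(k, p)) y v a j :
  mx_derive Q y v a j = 'D_v (fun z => Q z a j : R^o) y.
Proof. by rewrite unlock mxE. Qed.

Section Frobenius.
Variable R : realType.

Lemma quadratic_differentiable k n (f : 'rV[R]_k -> 'rV[R]_n) (x : 'rV[R]_k)
    (A : 'M[R]_(k, n)) (C : R) :
  (\forall h \near (0 : 'rV[R]_k), `|f (x + h) - f x - h *m A| <= C * `|h| ^+ 2) ->
  differentiable f x /\ forall v, 'D_v f x = v *m A.
Proof.
move=> H.
have cA : continuous (mulmxr A : 'rV[R]_k -> 'rV[R]_n).
  move=> v; apply: differentiable_continuous; apply: differentiable_rV => j.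
  have -> : (fun y : 'rV[R]_k => (mulmxr A y) ord0 j : R^o) =
            \sum_i (fun y : 'rV[R]_k => (A i j : R) *: (y ord0 i : R^o)).
    apply/funext => y; rewrite fct_sumE mxE; apply: eq_bigr => i _.
    by rewrite mulrC.
  by apply: differentiable_sum => i; apply: differentiableZ; exact: differentiable_coord.
have E : f \o shift x = cst (f x) + mulmxr A +o_ (0 : 'rV[R]_k) id.
  apply/eqaddoP => e e0.
  (* No sign is assumed of [C]; [C'] is an upper bound of it by which one can divide. *)
  pose C' := `|C| + 1.
  have C'0 : 0 < C' by rewrite /C' ltr_wpDl.
  have N : \forall h \near (0 : 'rV[R]_k), `|h| < e / C'.
    have /cvgrPdist_lt/(_ _ (divr_gt0 e0 C'0)) : (id : 'rV[R]_k -> _) @ (0 : 'rV[R]_k) --> (0 : 'rV[R]_k) by exact: cvg_id.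
    by apply: filterS => h; rewrite sub0r normrN.
  apply: filterS2 H N => h Hh hN.
  rewrite -[X in `|X|]/(f (h + x) - (f x + h *m A)) [h + x]addrC opprD addrA.
  rewrite (le_trans Hh)//= expr2 mulrA ler_wpM2r//.
  rewrite (@le_trans _ _ (C' * `|h|))//.
    by rewrite ler_wpM2r// /C' (le_trans (ler_norm _))// lerDl.
  by rewrite mulrC -ler_pdivlMr// ltW.
have dE := diff_unique cA E.
have df : differentiable f x by apply/diff_locallyP; rewrite dE.
by split=> // v; rewrite deriveE// dE.
Qed.

Lemma norm_mulmx_le k n (v : 'rV[R]_k) (A : 'M[R]_(k, n)) (c : R) : 0 <= c ->
  (forall a j, `|A a j| <= c) -> `|v *m A| <= `|v| * (k%:R * c).
Proof.
move=> c0 Ac; apply/mx_norm_leP => [|i j]; first by rewrite !mulr_ge0.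
rewrite mxE; have -> : k%:R * c = \sum_(a < k) c.
  by rewrite sumr_const card_ord mulr_natl.
by apply: ler_norm_sum_mul => // a; rewrite ?ord1; exact: entry_norm_le.
Qed.

Lemma is_derive_rV n (f : R -> 'rV[R]_n) (t : R) (df : 'rV[R]_n) :
  (forall j, is_derive t 1 (fun s => f s ord0 j : R) (df ord0 j)) -> is_derive t 1 f df.
Proof.
move=> H; have Df : derivable f t 1.
  by apply/derivable_mxP => i j; rewrite ord1; case: (H j).
by apply: DeriveDef => //; rewrite derive_mx//; apply/rowP => j; rewrite mxE; case: (H j).
Qed.

Lemma is_derive_scale_id n (f : R -> 'rV[R]_n) (t : R) (df : 'rV[R]_n) :
  is_derive t 1 f df -> is_derive t 1 (fun s : R => s *: f s) (f t + t *: df).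
Proof.
move=> fd; apply: is_derive_rV => j.
have -> : (fun s : R => (s *: f s) ord0 j : R) = (id : R -> R) * (fun s => f s ord0 j).
  by apply/funext => s; rewrite mxE.
have fj := is_derive_entry ord0 j fd.
have -> : (f t + t *: df) ord0 j = t *: df ord0 j + (f t ord0 j : R) *: (1 : R).
  by rewrite !mxE addrC [_ *: 1]mulr1.
exact: is_deriveM.
Qed.

Lemma is_derive_comp n m (u : R -> 'rV[R]_n) (g : 'rV[R]_n -> 'rV[R]_m) (t : R) du :
  is_derive t 1 u du -> differentiable g (u t) ->
  is_derive t 1 (g \o u) ('D_du g (u t)).
Proof.
move=> [ut uE] dg; have du' : differentiable u t by apply/derivable1_diffP.
apply: DeriveDef; first by apply/derivable1_diffP; exact: differentiable_comp.
have E := derive_chain (1 : R) du' dg; rewrite uE in E; exact: E.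
Qed.

Variables (k n : nat) (U : set 'rV[R]_n) (x0 : 'rV[R]_n) (Q : 'rV[R]_n -> 'M[R]_(k, n)).
Hypotheses (oU : open U) (Ux0 : U x0) (sQ : mx_smooth U Q).

Lemma mx_estimates : exists K rho : R, [/\ 0 <= K, 0 < rho &
    forall y, `|y - x0| < rho ->
    [/\ U y, forall a j, `|Q y a j| <= K,
      forall v a j, `|mx_derive Q y v a j| <= `|v| * K &
      forall z, `|z - x0| < rho -> forall a j, `|(Q z - Q y) a j| <= `|z - y| * K /\
        `|(Q z - Q y - mx_derive Q y (z - y)) a j| <= `|z - y| ^+ 2 * K]].
Proof.
have H (i : 'I_k * 'I_n) : exists Kr : R * R, [/\ 0 <= Kr.1, 0 < Kr.2 &
    forall y, `|y - x0| < Kr.2 ->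
    [/\ U y, `|Q y i.1 i.2| <= Kr.1,
      forall v, `|mx_derive Q y v i.1 i.2| <= `|v| * Kr.1 &
      forall z, `|z - x0| < Kr.2 -> `|(Q z - Q y) i.1 i.2| <= `|z - y| * Kr.1 /\
        `|(Q z - Q y - mx_derive Q y (z - y)) i.1 i.2| <= `|z - y| ^+ 2 * Kr.1]].
  have [K [r [K0 r0 Kr]]] := smooth_estimates oU Ux0 (sQ i.1 i.2).
  exists (K, r); split=> // y /Kr[Uy Qy Dy Dzy]; split=> // [v|z /Dzy].
    by rewrite mx_deriveE; exact: Dy.
  by rewrite !mxE mx_deriveE.
have [Kr HKr] := choice H.
(* The base value of the minimum below: it keeps [rho] positive and the ball inside [U] even when
   the matrix has no entries. *)
have [r0 r0gt0 U0] : exists2 r : R, 0 < r & forall y, `|y - x0| < r -> U y.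
  have /nbhs_ballP[r r0 rU] := open_near oU Ux0.
  by exists r => // y yr; apply: rU; rewrite -ball_normE/= distrC.
pose rho := \big[Num.min/r0]_i (Kr i).2.
have K0 i : 0 <= (Kr i).1 by have [] := HKr i.
have rle i : rho <= (Kr i).2 by exact: bigmin_le_cond.
have Kle i : (Kr i).1 <= \sum_i (Kr i).1.
  by rewrite (bigD1 i)//= lerDl sumr_ge0.
exists (\sum_i (Kr i).1), rho; split; first exact: sumr_ge0.
  by apply: lt_bigmin => // i _; have [] := HKr i.
move=> y yr; split.
- by apply: U0; rewrite (lt_le_trans yr)// /rho bigmin_idl ge_min lexx.
- move=> a j; have [_ _ /(_ y (lt_le_trans yr (rle _)))[_ H1 _ _]] := HKr (a, j).
  by rewrite (le_trans H1).
- move=> v a j; have [_ _ /(_ y (lt_le_trans yr (rle _)))[_ _ H1 _]] := HKr (a, j).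
  by rewrite (le_trans (H1 v))// ler_wpM2l.
- move=> z zr a j; have [_ _ /(_ y (lt_le_trans yr (rle _)))[_ _ _ H1]] := HKr (a, j).
  have [H2 H3] := H1 z (lt_le_trans zr (rle _)).
  split; first by rewrite (le_trans H2)// ler_wpM2l.
  by rewrite (le_trans H3)// ler_wpM2l// exprn_ge0.
Qed.

Lemma differentiable_mul_mx (h : 'rV[R]_k) y : U y ->
  differentiable (fun z => h *m Q z) y /\
  forall v, 'D_v (fun z => h *m Q z) y = h *m mx_derive Q y v.
Proof.
move=> Uy.
have sh : smooth_on U (fun z => h *m Q z).
  apply: smooth_rV => // j; have := mx_smooth_mul oU (mx_smooth_cst h oU) sQ; exact.
have dh := smooth_on_diff sh Uy; split=> // v; apply/rowP => j.
rewrite derive_entry//.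
have -> : (fun z => (h *m Q z) ord0 j : R^o) = \sum_a (fun z => (h ord0 a : R) *: (Q z a j : R^o)).
  by apply/funext => z; rewrite fct_sumE mxE.
have dQ a : differentiable (fun z => Q z a j : R^o) y by exact: smooth_on_diff (sQ a j) Uy.
rewrite derive_sum; last first.
  by move=> a; apply/diff_derivable/differentiableZ.
rewrite mxE; apply: eq_bigr => a _; rewrite mx_deriveE.
by rewrite [LHS]deriveZ//; exact: diff_derivable.
Qed.

(* [gamma s] is the time-one value of the integral curve of the constant
   combination [s *m Q]. Moving [s] to [s + h], commutation makes
   [t |-> gamma (t s) + t h Q(gamma (t s))] solve the new equation up to an
   error of order [|h|^2]. *)
Theorem frobenius_commuting :
  (forall y, U y -> forall s h,
     s *m mx_derive Q y (h *m Q y) = h *m mx_derive Q y (s *m Q y)) ->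
  exists (r : R) (gamma : 'rV[R]_k -> 'rV[R]_n), [/\ 0 < r, gamma 0 = x0 &
    forall s, `|s| < r -> [/\ U (gamma s), differentiable gamma s &
      forall v, 'D_v gamma s = v *m Q (gamma s)]].
Proof.
move=> comm.
have [K [rho [K0 rho0 est]]] := mx_estimates.
pose kap := k%:R * K.
have kap0 : 0 <= kap by rewrite mulr_ge0.
(* Two demands on [|s| * kap]: at most 1/2, the Lipschitz constant in [picard] and [gronwall_half],
   and at most rho / 4, which keeps the curves in the quarter ball and leaves room for the
   comparison curve [w] below. *)
pose mr := Num.min 1 (rho / 2).
have mr0 : 0 < mr by rewrite lt_min ltr01 divr_gt0.
pose r := mr / (2 * (kap + 1)).
have kap1 : 0 < kap + 1 by rewrite ltr_wpDl.
have r0 : 0 < r by rewrite divr_gt0// mulr_gt0.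
have kr (s : 'rV[R]_k) : `|s| < r -> `|s| * kap <= mr / 2.
  move=> sr; apply: (@le_trans _ _ (r * (kap + 1))).
    by rewrite ler_pM// ?ltW// ltrDl.
  by rewrite /r invfM mulrA -mulrA mulVf ?gt_eqF// mulr1.
have mr1 : mr / 2 <= 1 / 2 by apply: ler_wpM2r; [rewrite invr_ge0|rewrite /mr ge_min lexx].
have mrr : mr / 2 <= rho / 4.
  have -> : rho / 4 = rho / 2 / 2 by field.
  by apply: ler_wpM2r; [rewrite invr_ge0|rewrite /mr ge_min lexx orbT].
have small (y : 'rV[R]_n) : `|y - x0| <= rho / 4 -> `|y - x0| < rho.
  by move=> yr; rewrite (le_lt_trans yr)// ltr_pdivrMr// ltr_pMr// ltr1n.
have Qn (y : 'rV[R]_n) (v : 'rV[R]_k) : `|y - x0| < rho -> `|v *m Q y| <= `|v| * kap.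
  by move=> /est[_ Qy _ _]; exact: norm_mulmx_le.
have QL (y z : 'rV[R]_n) (v : 'rV[R]_k) : `|y - x0| < rho -> `|z - x0| < rho ->
    `|v *m Q z - v *m Q y| <= `|v| * kap * `|z - y|.
  move=> /est[_ _ _ H] zr; rewrite -mulmxBr.
  apply: (le_trans (norm_mulmx_le _ (_ : 0 <= `|z - y| * K) _)).
  - by rewrite mulr_ge0.
  - by move=> a j; have [] := H z zr a j.
  - by rewrite /kap le_eqVlt; apply/orP; left; apply/eqP; ring.
have DQn (y : 'rV[R]_n) (v : 'rV[R]_k) (w : 'rV[R]_n) : `|y - x0| < rho -> `|v *m mx_derive Q y w| <= `|v| * kap * `|w|.
  move=> /est[_ _ Dy _].
  apply: (le_trans (norm_mulmx_le _ (_ : 0 <= `|w| * K) _)).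
  - by rewrite mulr_ge0.
  - exact: Dy.
  - by rewrite /kap le_eqVlt; apply/orP; left; apply/eqP; ring.
have TQn (y z : 'rV[R]_n) (v : 'rV[R]_k) : `|y - x0| < rho -> `|z - x0| < rho ->
    `|v *m (Q z - Q y - mx_derive Q y (z - y))| <= `|v| * kap * `|z - y| ^+ 2.
  move=> /est[_ _ _ H] zr.
  apply: (le_trans (norm_mulmx_le _ (_ : 0 <= `|z - y| ^+ 2 * K) _)).
  - by rewrite mulr_ge0// exprn_ge0.
  - by move=> a j; have [] := H z zr a j.
  - by rewrite /kap le_eqVlt; apply/orP; left; apply/eqP; ring.
have curve (s : 'rV[R]_k) : exists u : R -> 'rV[R]_n, `|s| < r -> u 0 = x0 /\
    forall t : R, 0 <= t <= 1 -> `|u t - x0| <= rho / 4 /\ is_derive t 1 u (s *m Q (u t)).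
  have [sr|] := boolP (`|s| < r); last by exists (cst x0).
  have rho4 : 0 <= rho / 4 by rewrite divr_ge0// ltW.
  have [|y z yr zr|u [u0 uP]] := @picard R n (fun y => s *m Q y) x0 (rho / 4) rho4.
  - move=> y yr; rewrite (le_trans (Qn _ _ (small _ yr)))//.
    by rewrite (le_trans (kr _ sr)).
  - rewrite (le_trans (QL _ _ _ (small _ zr) (small _ yr)))// mulrC ler_wpM2l//.
    by rewrite (le_trans (kr _ sr))// (le_trans mr1)// mul1r.
  - by exists u.
have [u uP] := choice curve.
(* With h = s' - s, Gronwall doubles 3/2 kap^2 |h|^2. There 1/2 comes from the Taylor remainder of
   [Q], weighted by |s'| kap <= 1/2, and 1 from [h] times the derivative of [Q] along w - u. *)
have key (s s' : 'rV[R]_k) : `|s| < r -> `|s'| < r ->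
    `|u s' 1 - u s 1 - (s' - s) *m Q (u s 1)| <= 3 * kap ^+ 2 * `|s' - s| ^+ 2.
  move=> sr s'r; set h := s' - s.
  have [us0 us] := uP s sr; have [us'0 us'] := uP s' s'r.
  have ur (t : R) : 0 <= t <= 1 -> `|u s t - x0| < rho by move=> /us[/small].
  have u'r (t : R) : 0 <= t <= 1 -> `|u s' t - x0| < rho by move=> /us'[/small].
  pose w (t : R) := u s t + t *: (h *m Q (u s t)).
  have hk : `|h| * kap <= rho / 2.
    rewrite (@le_trans _ _ (`|s'| * kap + `|s| * kap))//.
      by rewrite -mulrDl ler_wpM2r// ler_normB.
    have -> : rho / 2 = rho / 4 + rho / 4 by field.
    by apply: lerD; apply: (le_trans (kr _ _)).
  have thk (t : R) : 0 <= t <= 1 -> `|t *: (h *m Q (u s t))| <= `|h| * kap.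
    move=> t01; have [t0 t1] := andP t01; rewrite normrZ ger0_norm//.
    rewrite (le_trans (ler_wpM2l t0 (Qn _ h (ur t t01))))//.
    by rewrite ler_piMl// mulr_ge0.
  have wr (t : R) : 0 <= t <= 1 -> `|w t - x0| < rho.
    move=> t01; rewrite /w addrAC (le_lt_trans (ler_normD _ _))//.
    apply: (@le_lt_trans _ _ (rho / 4 + rho / 2)).
      by apply: lerD; [have [] := us t t01|exact: le_trans (thk t t01) hk].
    have -> : rho / 4 + rho / 2 = rho * (3 / 4) by field.
    by rewrite gtr_pMr// ltr_pdivrMr// mul1r ltr_nat.
  pose dw (t : R) := s *m Q (u s t) + (h *m Q (u s t) +
     t *: (h *m mx_derive Q (u s t) (s *m Q (u s t)))).
  have wd (t : R) : 0 <= t <= 1 -> is_derive t 1 w (dw t).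
    move=> t01; have [_ ud] := us t t01.
    have [Uu _ _ _] := est _ (ur t t01).
    have [dq dqE] := differentiable_mul_mx h Uu.
    have := is_derive_scale_id (is_derive_comp ud dq).
    by rewrite dqE => ?; exact: is_deriveD.
  pose e (t : R) := u s' t - w t.
  have e0 : e 0 = 0 by rewrite /e /w us0 us'0 scale0r addr0 subrr.
  have ed (t : R) : 0 <= t <= 1 -> is_derive t 1 e (s' *m Q (u s' t) - dw t).
    move=> t01; have ? := wd t t01; have [_ ?] := us' t t01.
    exact: is_deriveB.
  have Dlin (z : R) (y v : 'rV[R]_n) : U y -> mx_derive Q y (z *: v) = z *: mx_derive Q y v.
    move=> Uy; apply/matrixP => a j; rewrite [RHS]mxE !mx_deriveE.
    have dq : differentiable (fun y => Q y a j : R^o) y by exact: smooth_on_diff (sQ a j) Uy.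
    by rewrite !deriveE// linearZ.
  (* Commutation turns the term t h DQ(s Q) of [dw] into t s DQ(h Q) = s DQ(w - u), which is the
     first-order term in the expansion of s Q(w) at u. This is the only use of [comm]. *)
  have eE (t : R) : 0 <= t <= 1 -> s' *m Q (u s' t) - dw t =
     (s' *m Q (u s' t) - s' *m Q (w t)) +
     (s' *m (Q (w t) - Q (u s t) - mx_derive Q (u s t) (w t - u s t)) +
      h *m mx_derive Q (u s t) (w t - u s t)).
    move=> t01; have [Uu _ _ _] := est _ (ur t t01).
    have wu : w t - u s t = t *: (h *m Q (u s t)) by rewrite /w addrC addKr.
    rewrite wu /dw -(comm _ Uu s h) Dlin//.
    move: (mx_derive Q (u s t) _) => B; move: (Q (u s t)) (Q (w t)) (Q (u s' t)) => Qu Qw Q'.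
    have -> : s' = s + h by rewrite /h addrC subrK.
    rewrite !mulmxBr !mulmxDl -!scalemxAr.
    move: (s *m B) (h *m B) (s *m Qu) (h *m Qu) (s *m Qw) (h *m Qw) (s *m Q') (h *m Q').
    by move=> a1 a2 a3 a4 a5 a6 a7 a8; apply/rowP => j; rewrite !mxE; ring.
  have eb (t : R) : 0 <= t <= 1 -> `|s' *m Q (u s' t) - dw t| <= `|e t| / 2 + (3 / 2) * kap ^+ 2 * `|h| ^+ 2.
    move=> t01; rewrite eE// (le_trans (ler_normD _ _))// lerD//.
      rewrite (le_trans (QL _ _ _ (wr t t01) (u'r t t01)))// mulrC ler_wpM2l//.
      by rewrite (le_trans (kr _ s'r))// (le_trans mr1)// mul1r.
    have wu : `|w t - u s t| <= `|h| * kap by rewrite /w addrC addKr thk.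
    have -> : 3 / 2 * kap ^+ 2 * `|h| ^+ 2 = 1 / 2 * (`|h| * kap) ^+ 2 + `|h| * kap * (`|h| * kap).
      by field.
    rewrite (le_trans (ler_normD _ _))// lerD//.
      rewrite (le_trans (TQn _ _ _ (ur t t01) (wr t t01)))//.
      apply: ler_pM; rewrite ?mulr_ge0 ?exprn_ge0//.
        by rewrite (le_trans (kr _ s'r)).
      by rewrite ler_pXn2r ?nnegrE ?mulr_ge0.
    rewrite (le_trans (DQn _ _ _ (ur t t01)))// ler_wpM2l// mulr_ge0//.
  have := gronwall_half e0 ed eb.
  rewrite /e /w scale1r opprD addrA => /le_trans; apply.
  by rewrite le_eqVlt; apply/orP; left; apply/eqP; field.
exists r, (fun s => u s 1); split=> //.
  have z : `|0 : 'rV[R]_k| < r by rewrite normr0.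
  have [u00 u0] := uP 0 z.
  have t11 : 0 <= (1 : R) <= 1 by rewrite ler01 lexx.
  have Z := @mean_value_ineq R _ _ (u 0) (fun t => 0 *m Q (u 0 t)) 0 1 0 ler01 (lexx _).
  apply/eqP; rewrite -subr_eq0 -normr_eq0 eq_le normr_ge0 andbT -[X in _ - X]u00.
  rewrite (le_trans (Z _ _)) ?mul0r//.
  - by move=> t /u0[].
  - by move=> t _; rewrite mul0mx normr0.
move=> s sr; have [us0 us] := uP s sr.
have t11 : 0 <= (1 : R) <= 1 by rewrite ler01 lexx.
have [us1 _] := us 1 t11; have [Uu _ _ _] := est _ (small _ us1).
have N : \forall h \near (0 : 'rV[R]_k),
    `|u (s + h) 1 - u s 1 - h *m Q (u s 1)| <= 3 * kap ^+ 2 * `|h| ^+ 2.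
  have p : 0 < r - `|s| by rewrite subr_gt0.
  have /cvgrPdist_lt/(_ _ p) : (id : 'rV[R]_k -> _) @ (0 : 'rV[R]_k) --> (0 : 'rV[R]_k) by exact: cvg_id.
  apply: filterS => h; rewrite sub0r normrN => hr.
  have shr : `|s + h| < r.
    by rewrite (le_lt_trans (ler_normD _ _))// -ltrBrDl.
  by have := key s (s + h) sr shr; rewrite [s + h - s]addrC addKr.
by have [d dE] := quadratic_differentiable (f := fun s => u s 1) N; split.
Qed.

End Frobenius.

Section FlowSmooth.
Variables (R : realType) (k n : nat).

(** Only differentiability of gamma is known. The functions [g \o gamma] with [g] smooth form a
    family stable under derivatives, since d gamma = Q(gamma) makes ['D_v (g \o gamma)] the
    composite with gamma of the derivative of [g] along [v *m Q]. *)
Lemma smooth_flow1 (B : set 'rV[R]_k) (V : set 'rV[R]_n) (Q : 'rV[R]_n -> 'M[R]_(k, n))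
    (gamma : 'rV[R]_k -> 'rV[R]_n) (f : 'rV[R]_n -> R^o) :
  open B -> open V -> mx_smooth V Q ->
  (forall s, B s -> [/\ V (gamma s), differentiable gamma s &
     forall v, 'D_v gamma s = v *m Q (gamma s)]) ->
  smooth_on V f -> @smooth_on R k R^o B (f \o gamma).
Proof.
move=> oB oV sQ flow sf.
pose G : set ('rV[R]_k -> R^o) :=
  [set h | exists2 g : 'rV[R]_n -> R^o, smooth_on V g & h = g \o gamma].
apply: (@alg_smooth _ _ _ oB G); last by apply: alg_gen; exists f.
move=> _ [g sg ->]; split=> [s /flow[Vs ds _]|v].
  by apply: differentiable_comp => //; exact: smooth_on_diff sg Vs.
pose gv y : R^o := \sum_j ((v *m Q y) ord0 j : R) * ('D_(delta_mx ord0 j) g y : R).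
have sgv : smooth_on V gv.
  apply: smooth_sum => // j; apply: smooth_mul => //; last exact: smooth_on_derive.
  have := mx_smooth_mul oV (mx_smooth_cst v oV) sQ; exact.
have Ggv : alg B G (gv \o gamma) by apply: alg_gen; exists gv.
apply: (alg_ext Ggv) => s /flow[Vs ds dE].
have dg := smooth_on_diff sg Vs.
by rewrite (derive_chain _ ds dg) dE (derive_sum_basis _ dg).
Qed.

Lemma smooth_flow m (B : set 'rV[R]_k) (V : set 'rV[R]_n) (Q : 'rV[R]_n -> 'M[R]_(k, n))
    (gamma : 'rV[R]_k -> 'rV[R]_n) (f : 'rV[R]_n -> 'rV[R]_m) :
  open B -> open V -> mx_smooth V Q ->
  (forall s, B s -> [/\ V (gamma s), differentiable gamma s &
     forall v, 'D_v gamma s = v *m Q (gamma s)]) ->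
  smooth_on V f -> smooth_on B (f \o gamma).
Proof.
move=> oB oV sQ flow sf; apply: smooth_rV => // j.
by apply: (smooth_flow1 (f := fun y => f y ord0 j) oB oV sQ flow); exact: smooth_entry.
Qed.

End FlowSmooth.

(** * Closed 2-forms and their kernels *)

Section MatrixDerivative.
Variables (R : realType) (n : nat) (U : set 'rV[R]_n).
Hypothesis oU : open U.

Lemma mx_derive_ext k p (A B : 'rV[R]_n -> 'M[R]_(k, p)) y v :
  (forall z, U z -> A z = B z) -> U y -> mx_derive A y v = mx_derive B y v.
Proof.
move=> AB Uy; apply/matrixP => a j; rewrite !mx_deriveE.
by apply: (@derive_eq_on _ _ _ oU R^o) => // z Uz; rewrite AB.
Qed.

Lemma mx_derive_cst k p (A : 'M[R]_(k, p)) (y v : 'rV[R]_n) :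
  mx_derive (cst A) y v = 0.
Proof. by apply/matrixP => a j; rewrite mx_deriveE mxE; exact: derive_cst. Qed.

Lemma mx_derive_mul k p q (A : 'rV[R]_n -> 'M[R]_(k, p)) (B : 'rV[R]_n -> 'M[R]_(p, q)) y v :
  mx_smooth U A -> mx_smooth U B -> U y ->
  mx_derive (fun z => A z *m B z) y v = mx_derive A y v *m B y + A y *m mx_derive B y v.
Proof.
move=> sA sB Uy; apply/matrixP => a j; rewrite mx_deriveE !mxE.
have dA b : differentiable (fun z => A z a b : R^o) y by exact: smooth_on_diff (sA a b) Uy.
have dB b : differentiable (fun z => B z b j : R^o) y by exact: smooth_on_diff (sB b j) Uy.
have -> : (fun z => (A z *m B z) a j : R^o) =
    \sum_b ((fun z => A z a b : R) * (fun z => B z b j : R)).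
  by apply/funext => z; rewrite fct_sumE mxE.
rewrite derive_sum; last by move=> b; apply/diff_derivable/differentiableM.
rewrite -big_split/=; apply: eq_bigr => b _; rewrite !mx_deriveE.
rewrite [LHS]deriveM; [|exact/diff_derivable|exact/diff_derivable].
by rewrite addrC; congr (_ + _); exact: mulrC.
Qed.

Lemma mx_derive_tr k p (A : 'rV[R]_n -> 'M[R]_(k, p)) y v :
  mx_derive (fun z => (A z)^T) y v = (mx_derive A y v)^T.
Proof.
apply/matrixP => a j; rewrite [RHS]mxE !mx_deriveE.
have -> : (fun z => (A z)^T a j : R^o) = (fun z => A z j a : R^o).
  by apply/funext => z; rewrite mxE.
by [].
Qed.

Lemma mx_derive_comp m k p (V : set 'rV[R]_m) (f : 'rV[R]_n -> 'rV[R]_m)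
    (A : 'rV[R]_m -> 'M[R]_(k, p)) y v :
  smooth_on U f -> mx_smooth V A -> U y -> V (f y) ->
  mx_derive (A \o f) y v = mx_derive A (f y) (v *m 'J f y).
Proof.
move=> sf sA Uy Vy; apply/matrixP => a j; rewrite !mx_deriveE.
have df := smooth_on_diff sf Uy; have dA := smooth_on_diff (sA a j) Vy.
rewrite -(deriveEjacobian v df).
have E := @derive_chain R _ m R^o f (fun z => A z a j : R^o) y v df dA.
exact: E.
Qed.

Lemma mx_smooth_comp m k p (V : set 'rV[R]_m) (f : 'rV[R]_n -> 'rV[R]_m)
    (A : 'rV[R]_m -> 'M[R]_(k, p)) : open V ->
  smooth_on U f -> mx_smooth V A -> (forall y, U y -> V (f y)) -> mx_smooth U (A \o f).
Proof.
move=> oV sf sA fUV a j.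
exact: (smooth_comp1 (g := fun z => A z a j : R^o) oU oV sf (sA a j) fUV).
Qed.

(** Symmetry of the second derivatives of [f], in the form in which it enters the closedness of a
    pullback. *)
Lemma mx_derive_jacobian_sym m (f : 'rV[R]_n -> 'rV[R]_m) y (u v : 'rV[R]_n) :
  smooth_on U f -> U y ->
  u *m mx_derive (fun z => 'J f z) y v = v *m mx_derive (fun z => 'J f z) y u.
Proof.
move=> sf Uy.
have E (a b : 'rV[R]_n) j : (a *m mx_derive (fun z => 'J f z) y b) ord0 j =
    'D_b ('D_a (fun z => f z ord0 j : R^o)) y.
  have sJ := mx_smooth_jacobian oU sf.
  transitivity (mx_derive (fun z => a *m 'J f z) y b ord0 j).
    rewrite (mx_derive_mul _ (mx_smooth_cst a oU) sJ Uy) mx_derive_cst mul0mx add0r.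
    by rewrite mxE.
  rewrite mx_deriveE; apply: (@derive_eq_on _ _ _ oU R^o) => // z Uz.
  have dfz := smooth_on_diff sf Uz.
  by rewrite -deriveEjacobian// derive_entry.
apply/rowP => j.
have S := schwarz u v oU (smooth_entry ord0 j oU sf) Uy.
exact: etrans (E u v j) (etrans (esym S) (esym (E v u j))).
Qed.

End MatrixDerivative.

Section ClosedForm.
Variable R : realType.

(* [W y] is the matrix of the form at [y]; the last clause is [dW = 0]. *)
Definition closed_form n (U : set 'rV[R]_n) (W : 'rV[R]_n -> 'M[R]_n) : Prop :=
  [/\ mx_smooth U W, forall y, U y -> (W y)^T = - W y &
    forall y, U y -> forall a b c : 'rV[R]_n,
      a *m mx_derive W y c *m b^T + b *m mx_derive W y a *m c^T +
      c *m mx_derive W y b *m a^T = 0].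

Lemma tr11 (A : 'M[R]_1) : A^T = A.
Proof. by apply/matrixP => i j; rewrite mxE !ord1. Qed.

Lemma skew_form n (A : 'M[R]_n) (p q : 'rV[R]_n) : A^T = - A ->
  p *m A *m q^T = - (q *m A *m p^T).
Proof.
move=> sA; rewrite -[LHS]tr11 !trmx_mul trmxK sA.
by rewrite mulNmx mulmxN mulmxA.
Qed.

Lemma skew_derive n (U : set 'rV[R]_n) (W : 'rV[R]_n -> 'M[R]_n) y v : open U ->
  mx_smooth U W -> (forall y, U y -> (W y)^T = - W y) -> U y ->
  (mx_derive W y v)^T = - mx_derive W y v.
Proof.
move=> oU sW skW Uy; rewrite -mx_derive_tr (mx_derive_ext oU v skW Uy).
apply/matrixP => a j; rewrite mx_deriveE mxE mx_deriveE.
have dW := smooth_on_diff (sW a j) Uy.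
have -> : (fun z => (- W z) a j : R^o) = - (fun z => W z a j : R^o).
  by apply/funext => z; rewrite mxE.
by rewrite deriveN//; exact: diff_derivable.
Qed.

(** The pointwise algebra of d commuting with pullback: [J] stands for the derivative of the map and
    [H] for its second derivative. Symmetry of [H] and skewness of [W] cancel the six terms in [H]
    in pairs, leaving dW on the images under [J]. *)
Lemma cyclic_pullback n m (J : 'M[R]_(n, m)) (W : 'M[R]_m)
    (H : 'rV[R]_n -> 'M[R]_(n, m)) (DW : 'rV[R]_m -> 'M[R]_m) :
  W^T = - W -> (forall u v, u *m H v = v *m H u) ->
  (forall a b c, a *m DW c *m b^T + b *m DW a *m c^T + c *m DW b *m a^T = 0) ->
  forall u v z,
  (u *m H z *m W *m (v *m J)^T + u *m J *m DW (z *m J) *m (v *m J)^T + u *m J *m W *m (v *m H z)^T) +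
  (v *m H u *m W *m (z *m J)^T + v *m J *m DW (u *m J) *m (z *m J)^T + v *m J *m W *m (z *m H u)^T) +
  (z *m H v *m W *m (u *m J)^T + z *m J *m DW (v *m J) *m (u *m J)^T + z *m J *m W *m (u *m H v)^T) = 0.
Proof.
move=> skW Hsym cl u v z.
rewrite (Hsym z u) (Hsym u v) (Hsym z v) -[RHS](cl (u *m J) (v *m J) (z *m J)).
rewrite (skew_form (v *m J) (u *m H z) skW) (skew_form (u *m J) (v *m H z) skW).
rewrite (skew_form (z *m J) (v *m H u) skW).
move: (u *m H z *m W *m _) (v *m H u *m W *m _) (v *m H z *m W *m _).
move: (u *m J *m DW _ *m _) (v *m J *m DW _ *m _) (z *m J *m DW _ *m _).
by move=> *; apply/matrixP => i j; rewrite !mxE; ring.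
Qed.

Lemma closed_form_pullback n m (U : set 'rV[R]_n) (V : set 'rV[R]_m)
    (f : 'rV[R]_n -> 'rV[R]_m) (W : 'rV[R]_m -> 'M[R]_m) :
  open U -> open V -> smooth_on U f -> (forall x, U x -> V (f x)) ->
  closed_form V W ->
  closed_form U (fun x => 'J f x *m W (f x) *m ('J f x)^T).
Proof.
move=> oU oV sf fUV [sW skW clW].
have sJ := mx_smooth_jacobian oU sf.
have sWf := mx_smooth_comp oU oV sf sW fUV.
have sJW := mx_smooth_mul oU sJ sWf.
have sJT := mx_smooth_tr oU sJ.
split=> [|x Ux|x Ux u v z]; first exact: mx_smooth_mul.
  by rewrite !trmx_mul trmxK skW ?mulNmx ?mulmxN ?mulmxA//; exact: fUV.
have D (w : 'rV[R]_n) : mx_derive (fun x => 'J f x *m W (f x) *m ('J f x)^T) x w =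
  (mx_derive (fun x => 'J f x) x w *m W (f x) + 'J f x *m mx_derive W (f x) (w *m 'J f x)) *m ('J f x)^T
    + 'J f x *m W (f x) *m (mx_derive (fun x => 'J f x) x w)^T.
  rewrite (mx_derive_mul w sJW sJT Ux) mx_derive_tr.
  rewrite (mx_derive_mul w sJ sWf Ux).
  by rewrite (mx_derive_comp w sf sW Ux (fUV _ Ux)).
have D' (p q w : 'rV[R]_n) : p *m mx_derive (fun x => 'J f x *m W (f x) *m ('J f x)^T) x w *m q^T =
    (p *m mx_derive (fun x => 'J f x) x w) *m W (f x) *m (q *m 'J f x)^T
  + (p *m 'J f x) *m mx_derive W (f x) (w *m 'J f x) *m (q *m 'J f x)^T
  + (p *m 'J f x) *m W (f x) *m (q *m mx_derive (fun x => 'J f x) x w)^T.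
  by rewrite D !trmx_mul !(mulmxDl, mulmxDr) !mulmxA.
apply: etrans (f_equal2 +%R (f_equal2 +%R (D' u v z) (D' v z u)) (D' z u v)) _.
apply: (@cyclic_pullback _ _ ('J f x) (W (f x)) (mx_derive (fun x => 'J f x) x) (mx_derive W (f x))).
- exact: skW (fUV _ Ux).
- by move=> a b; exact: (mx_derive_jacobian_sym oU a b sf Ux).
- exact: clW (fUV _ Ux).
Qed.

(** [H] stands for the derivative of the frame and [DW] for that of the form, so that [D] below is
    the bracket of the fields h Q and s Q. Closedness puts [D] in the kernel, so D = a Q, and
    [D *m Pi = 0] then reads a = 0. *)
Lemma kernel_commute n k (Q : 'M[R]_(k, n)) (w : 'M[R]_n)
    (H : 'rV[R]_n -> 'M[R]_(k, n)) (DW : 'rV[R]_n -> 'M[R]_n) (Pi : 'M[R]_(n, k)) :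
  Q *m w = 0 -> Q *m Pi = 1%:M -> w^T = - w ->
  (forall v, (DW v)^T = - DW v) ->
  (forall v, H v *m w + Q *m DW v = 0) -> (forall v, H v *m Pi = 0) ->
  (forall a b c, a *m DW c *m b^T + b *m DW a *m c^T + c *m DW b *m a^T = 0) ->
  (forall v : 'rV[R]_n, v *m w = 0 -> exists a, v = a *m Q) ->
  forall s h, s *m H (h *m Q) = h *m H (s *m Q).
Proof.
move=> Qw QPi skw skD Qw' QPi' clw wQ s h.
apply/eqP; rewrite -subr_eq0; apply/eqP.
set D := _ - _.
have DPi : D *m Pi = 0 by rewrite /D mulmxBl -!mulmxA !QPi' !mulmx0 subrr.
suff /wQ[a Da] : D *m w = 0.
  by move: DPi; rewrite Da -mulmxA QPi// mulmx1 => ->; rewrite mul0mx.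
suff E (z : 'rV[R]_n) : D *m w *m z^T = 0.
  apply/rowP => j; have /matrixP/(_ ord0 ord0) := E (delta_mx ord0 j).
  by rewrite trmx_delta -colE !mxE.
have Qv (a : 'rV[R]_k) v : a *m Q *m DW v = - (a *m H v *m w).
  by rewrite -!mulmxA -mulmxN; congr (_ *m _); apply/eqP; rewrite -addr_eq0 addrC Qw'.
have wQT (a : 'rV[R]_k) : w *m (a *m Q)^T = 0.
  apply: trmx_inj; rewrite trmx_mul trmxK skw mulmxN -mulmxA Qw mulmx0 oppr0.
  by rewrite trmx0.
(* Closedness on two kernel vectors and an arbitrary [z]. Differentiating Q w = 0 replaces Q DW by
   -H w; the summand differentiated along [z] dies on w (h Q)^T = 0, and the other two add up to D w
   z^T. *)
have := clw (s *m Q) (h *m Q) z.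
rewrite (skew_form z (s *m Q) (skD _)) !Qv !mulNmx -(mulmxA _ w (h *m Q)^T) wQT mulmx0 oppr0 add0r opprK => E.
by rewrite /D !mulmxBl addrC.
Qed.

Lemma closed_form_kernel_involutive n k (U : set 'rV[R]_n) (w : 'rV[R]_n -> 'M[R]_n)
    (Q : 'rV[R]_n -> 'M[R]_(k, n)) (Pi : 'M[R]_(n, k)) :
  open U -> closed_form U w -> mx_smooth U Q ->
  (forall y, U y -> Q y *m w y = 0) ->
  (forall y, U y -> forall v : 'rV[R]_n, v *m w y = 0 -> exists a, v = a *m Q y) ->
  (forall y, U y -> Q y *m Pi = 1%:M) ->
  forall y, U y -> forall s h : 'rV[R]_k,
    s *m mx_derive Q y (h *m Q y) = h *m mx_derive Q y (s *m Q y).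
Proof.
move=> oU [sw skw clw] sQ Qw wQ QPi y Uy s h.
have Qw' v : mx_derive Q y v *m w y + Q y *m mx_derive w y v = 0.
  rewrite -(mx_derive_mul v sQ sw Uy) (mx_derive_ext oU (B := cst 0) v Qw Uy).
  exact: mx_derive_cst.
have QPi' v : mx_derive Q y v *m Pi = 0.
  have := mx_derive_mul v sQ (mx_smooth_cst Pi oU) Uy.
  rewrite mx_derive_cst mulmx0 addr0 => <-.
  rewrite (mx_derive_ext oU (B := cst 1%:M) v QPi Uy).
  exact: mx_derive_cst.
apply: (@kernel_commute _ _ (Q y) (w y) (mx_derive Q y) (mx_derive w y) Pi) => //.
- exact: Qw.
- exact: QPi.
- exact: skw.
- by move=> v; exact: (skew_derive v oU sw skw Uy).
- exact: clw.
- exact: wQ.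
Qed.

End ClosedForm.

(** * Charts and coordinate fields *)

(* Locked: comparing two Jacobians by unfolding them diverges. *)
HB.lock Definition jac (R : realType) (n m : nat) (N : manifold R n) (M : manifold R m)
    (c : chart R n N) (c' : chart R m M) (f : N -> M) (p : N) : 'M[R]_(n, m) :=
  'J (cmap c' \o f \o cinv c) (cmap c p).

Lemma jacE (R : realType) n m (N : manifold R n) (M : manifold R m)
    (c : chart R n N) (c' : chart R m M) (f : N -> M) (p : N) :
  jac c c' f p = 'J (cmap c' \o f \o cinv c) (cmap c p).
Proof. by rewrite unlock. Qed.

Section Charts.
Variable R : realType.

Lemma chart_image_open n (T : topologicalType) (c : chart R n T) (O : set T) :
  open O -> open (cmap c @` (cdom c `&` O)).
Proof.
move=> oO; rewrite openE => _ [p [cp Op] <-].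
have Vp : (cmap c @` cdom c) (cmap c p) by exists p.
have N1 := open_nbhs_nbhs (conj (@cimg_open _ _ _ c) Vp).
have N2 : nbhs (cmap c p) (cinv c @^-1` O).
  apply: (cinv_continuous Vp); rewrite (cmapK cp).
  exact: (open_nbhs_nbhs (conj oO Op)).
apply: filterS (filterI N1 N2) => _ [[q cq <-]]; rewrite /preimage/= (cmapK cq) => Oq.
by exists q.
Qed.

Lemma jacobian_eq_on n m (U : set 'rV[R]_n) (f g : 'rV[R]_n -> 'rV[R]_m) x :
  open U -> (forall y, U y -> f y = g y) -> U x -> differentiable f x ->
  'J f x = 'J g x.
Proof.
move=> oU fg Ux df; have dg := differentiable_eq_on oU fg Ux df.
apply/row_matrixP => i; apply: etrans (rowE i _) (etrans _ (esym (rowE i _))).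
apply: etrans (esym (deriveEjacobian _ df)) (etrans _ (deriveEjacobian _ dg)).
exact: (derive_eq_on oU).
Qed.

Lemma schwarz_rV n m (U : set 'rV[R]_n) (f : 'rV[R]_n -> 'rV[R]_m) (x u v : 'rV[R]_n) :
  open U -> smooth_on U f -> U x -> 'D_u ('D_v f) x = 'D_v ('D_u f) x.
Proof.
move=> oU sf Ux; apply/rowP => j.
have E (a b : 'rV[R]_n) : 'D_a ('D_b f) x ord0 j = 'D_a ('D_b (fun z => f z ord0 j : R^o)) x.
  rewrite derive_entry; last exact: smooth_on_diff (smooth_on_derive b sf) Ux.
  apply: (@derive_eq_on _ _ _ oU R^o) => // z Uz.
  by rewrite derive_entry//; exact: smooth_on_diff sf Uz.
apply: etrans (E u v) _; apply: etrans _ (esym (E v u)).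
exact: (schwarz u v oU (smooth_entry ord0 j oU sf) Ux).
Qed.

Lemma smooth_map_id n (M : manifold R n) : @smooth_map R n n M M id.
Proof. by split=> [x|c c' ca ca']; [exact: cvg_id|exact: atlas_compatible]. Qed.

Section Rep.
Variables (n m : nat) (N : manifold R n) (M : manifold R m) (f : N -> M).
Hypothesis sf : smooth_map f.
Variables (c : chart R n N) (c' : chart R m M).
Hypotheses (ca : atlas c) (ca' : atlas c').

Lemma rep_dom_open : open (cmap c @` (cdom c `&` f @^-1` cdom c')).
Proof.
apply: chart_image_open; apply: open_comp; last exact: (@cdom_open _ _ _ c').
by move=> x _; exact: sf.1.
Qed.

Lemma rep_differentiable p : cdom c p -> cdom c' (f p) ->
  differentiable (cmap c' \o f \o cinv c) (cmap c p).
Proof.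
by move=> cp cfp; apply: (smooth_on_diff (sf.2 c c' ca ca')); exists p.
Qed.

End Rep.

Lemma jac_comp n m l (N : manifold R n) (M : manifold R m) (P : manifold R l)
    (f : N -> M) (g : M -> P) c c' c'' p :
  smooth_map f -> smooth_map g -> atlas c -> atlas c' -> atlas c'' ->
  cdom c p -> cdom c' (f p) -> cdom c'' (g (f p)) ->
  jac c c'' (g \o f) p = jac c c' f p *m jac c' c'' g (f p).
Proof.
move=> sf sg ca ca' ca'' cp cfp cgp.
have df := rep_differentiable sf ca ca' cp cfp.
have dg := rep_differentiable sg ca' ca'' cfp cgp.
have E : (cmap c' \o f \o cinv c) (cmap c p) = cmap c' (f p) by rewrite /= cmapK.
rewrite -E in dg.
rewrite !jacE -E -(jacobian_chain df dg).
apply: esym; apply: (jacobian_eq_on (rep_dom_open sf (c := c) (c' := c'))).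
- by move=> _ [q [cq cfq] <-]; rewrite /= (cmapK cq) (cmapK cfq).
- by exists p.
- exact: differentiable_comp.
Qed.

Lemma jac_id n (M : manifold R n) (c : chart R n M) p :
  atlas c -> cdom c p -> jac c c id p = 1%:M.
Proof.
move=> ca cp; have -> : jac c c id p = 'J id (cmap c p).
  rewrite jacE; apply: (jacobian_eq_on (rep_dom_open (smooth_map_id M) (c := c) (c' := c))).
  - by move=> _ [q [cq _] <-]; rewrite /= (cmapK cq).
  - by exists p.
  - exact: (rep_differentiable (smooth_map_id M) ca ca cp cp).
apply/row_matrixP => i; apply: etrans (rowE i _) (etrans _ (esym (rowE i _))); rewrite mulmx1.
have did : differentiable (id : 'rV[R]_n -> 'rV[R]_n) (cmap c p) by [].
apply: etrans (esym (deriveEjacobian _ did)) _.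
exact: derive_id.
Qed.

Section Transition.
Variables (n : nat) (M : manifold R n).

Lemma jac_trans (c c' c'' : chart R n M) p : atlas c -> atlas c' -> atlas c'' ->
  cdom c p -> cdom c' p -> cdom c'' p ->
  jac c c' id p *m jac c' c'' id p = jac c c'' id p.
Proof.
move=> ? ? ? ? ? ?; apply: esym.
by apply: (jac_comp (f := id) (g := id)) => //; exact: smooth_map_id.
Qed.

Lemma jac_inv (c c' : chart R n M) p : atlas c -> atlas c' -> cdom c p -> cdom c' p ->
  jac c c' id p *m jac c' c id p = 1%:M.
Proof. by move=> ca ca' cp cp'; rewrite jac_trans// jac_id. Qed.

Lemma jac_unit (c c' : chart R n M) p : atlas c -> atlas c' -> cdom c p -> cdom c' p ->
  jac c c' id p \in unitmx.
Proof. by move=> ca ca' cp cp'; have [] := mulmx1_unit (jac_inv ca ca' cp cp'). Qed.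

Lemma jac_idE (c c' : chart R n M) p :
  jac c c' id p = 'J (cmap c' \o cinv c) (cmap c p).
Proof.
rewrite jacE; have -> : (cmap c' \o id) \o cinv c = cmap c' \o cinv c by [].
by [].
Qed.

Lemma vf_in_chartE (X : M -> 'rV[R]_n) c q : cdom c q ->
  vf_in_chart X c (cmap c q) = X q *m jac (chart_at q) c id q.
Proof. by move=> cq; rewrite /vf_in_chart jac_idE (cmapK cq). Qed.

(** The field with constant components [v] in [c0]. Its value at [q] has to be given in components
    of [chart_at q], hence a Jacobian that changes with [q]. *)
Definition coord_field (c0 : chart R n M) (v : 'rV[R]_n) (q : M) : 'rV[R]_n :=
  v *m jac c0 (chart_at q) id q.

Variables (c0 : chart R n M).
Hypothesis c0a : atlas c0.

Lemma coord_field_in_chart v c q : atlas c -> cdom c q -> cdom c0 q ->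
  vf_in_chart (coord_field c0 v) c (cmap c q) = v *m jac c0 c id q.
Proof.
move=> ca cq c0q; rewrite vf_in_chartE// /coord_field -mulmxA jac_trans//.
- exact: chart_at_atlas.
- exact: chart_at_dom.
Qed.

(** In any chart the components are a directional derivative of the transition map; smoothness and
    vanishing brackets of coordinate fields both come from this. *)
Lemma coord_field_rep v c q : atlas c -> cdom c q -> cdom c0 q ->
  vf_in_chart (coord_field c0 v) c (cmap c q) =
  'D_v (cmap c \o cinv c0) (cmap c0 q).
Proof.
move=> ca cq c0q; rewrite coord_field_in_chart// jac_idE; apply: esym; apply: deriveEjacobian.
exact: (rep_differentiable (smooth_map_id M) c0a ca c0q cq).
Qed.

Lemma coord_field_smooth v : smooth_vf (cdom c0) (coord_field c0 v).
Proof.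
move=> c ca.
have sth := atlas_compatible c0a ca; have sth' := atlas_compatible ca c0a.
have o1 := chart_image_open (c := c0) (@cdom_open _ _ _ c); have o2 := chart_image_open (c := c) (@cdom_open _ _ _ c0).
apply: (smooth_on_ext o2 (f := 'D_v (cmap c \o cinv c0) \o (cmap c0 \o cinv c))).
  by move=> _ [q [cq c0q] <-]; rewrite coord_field_rep//= (cmapK cq).
apply: (smooth_comp o2 o1 sth') => [|_ [q [cq c0q] <-]]; first exact: smooth_on_derive.
by exists q; rewrite //= (cmapK cq).
Qed.

Lemma coord_field_push v c q : atlas c -> cdom c q -> cdom c0 q ->
  coord_field c0 v q *m jac (chart_at q) c0 id q = v.
Proof.
move=> ca cq c0q; rewrite /coord_field -mulmxA jac_inv ?mulmx1//.
- exact: chart_at_atlas.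
- exact: chart_at_dom.
Qed.

Lemma derive_coord_field (W : normedModType R) (h : 'rV[R]_n -> W) v p :
  cdom c0 p -> differentiable h (cmap c0 p) ->
  'D_(coord_field c0 v p) (h \o (cmap c0 \o cinv (chart_at p))) (cmap (chart_at p) p) =
  'D_v h (cmap c0 p).
Proof.
move=> c0p dh; have ca := chart_at_atlas p; have cp := chart_at_dom p.
have dth : differentiable (cmap c0 \o cinv (chart_at p)) (cmap (chart_at p) p).
  exact: (rep_differentiable (smooth_map_id M) ca c0a cp c0p).
have E : (cmap c0 \o cinv (chart_at p)) (cmap (chart_at p) p) = cmap c0 p.
  by rewrite /= cmapK.
have dh' : differentiable h ((cmap c0 \o cinv (chart_at p)) (cmap (chart_at p) p)) by rewrite E.
rewrite (derive_chain _ dth dh') E (deriveEjacobian _ dth).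
by rewrite -jac_idE (coord_field_push v ca cp c0p).
Qed.

(** Both terms of the bracket are second derivatives of the same transition map. *)
Lemma lie_bracket_coord_field v w p : cdom c0 p ->
  lie_bracket (coord_field c0 v) (coord_field c0 w) p = 0.
Proof.
move=> c0p; have ca := chart_at_atlas p; have cp := chart_at_dom p.
set c := chart_at p.
have sth := atlas_compatible c0a ca.
have o1 := chart_image_open (c := c0) (@cdom_open _ _ _ c); have o2 := chart_image_open (c := c) (@cdom_open _ _ _ c0).
have E a b : 'D_(coord_field c0 a p) (vf_in_chart (coord_field c0 b) c) (cmap c p) =
    'D_a ('D_b (cmap c \o cinv c0)) (cmap c0 p).
  rewrite -(derive_coord_field a c0p); last first.
    by apply: (smooth_on_diff (smooth_on_derive b sth)); exists p.
  apply: (derive_eq_on o2); last by exists p.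
  by move=> _ [q [cq c0q] <-]; rewrite coord_field_rep//= (cmapK cq).
rewrite /lie_bracket -/c !E (schwarz_rV v w o1 sth) ?subrr//.
by exists p.
Qed.

Lemma vf_deriv_coord_field v (f : M -> R) p : smooth_fun (cdom c0) f -> cdom c0 p ->
  vf_deriv (coord_field c0 v) f p = @derive R _ R^o (f \o cinv c0) (cmap c0 p) v.
Proof.
move=> sf c0p; have ca := chart_at_atlas p; have cp := chart_at_dom p.
have o2 := chart_image_open (c := (chart_at p)) (@cdom_open _ _ _ c0).
rewrite /vf_deriv -(@derive_coord_field R^o (f \o cinv c0) v p c0p); last first.
  by apply: (smooth_on_diff (sf c0 c0a)); exists p.
apply: (@derive_eq_on _ _ _ o2 R^o); last by exists p.
by move=> _ [q [cq c0q] <-]; rewrite /= (cmapK cq) (cmapK c0q).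
Qed.

End Transition.

End Charts.

(** * The closed 2-form of a skew parallel tensor *)

Section FundamentalForm.
Variables (R : realType) (m : nat) (M : manifold R m) (g F : M -> 'M[R]_m).
Variable nabla : (M -> 'rV[R]_m) -> (M -> 'rV[R]_m) -> M -> 'rV[R]_m.
Hypotheses (hM : gFmu_manifold g F 1) (hnabla : levi_civita g nabla)
  (hpar : parallel nabla F).

Lemma innerE (p : M) v w : inner g p v w = (v *m g p *m w^T) ord0 ord0.
Proof. by []. Qed.

Lemma inner_sym p v w : inner g p v w = inner g p w v.
Proof. by case: hM => _ [+ _ _] _ _; exact. Qed.

Lemma inner_skew p v w : inner g p (v *m F p) w = - inner g p v (w *m F p).
Proof.
case: hM => _ _ _ /(_ p v w); rewrite mul1r => /eqP.
by rewrite addr_eq0 => /eqP.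
Qed.

Lemma mx_form_eq0 n (A : 'M[R]_n) :
  (forall v w : 'rV[R]_n, (v *m A *m w^T) ord0 ord0 = 0) -> A = 0.
Proof.
move=> H; apply/matrixP => i j; have := H (delta_mx ord0 i) (delta_mx ord0 j).
by rewrite trmx_delta -colE mxE -rowE !mxE.
Qed.

Lemma form_tr n (A : 'M[R]_n) (a b : 'rV[R]_n) : a *m A^T *m b^T = b *m A *m a^T.
Proof. by rewrite -[RHS]tr11 !trmx_mul trmxK mulmxA. Qed.

Lemma Fg_skew p : (F p *m g p)^T = - (F p *m g p).
Proof.
apply/eqP; rewrite -addr_eq0; apply/eqP; apply: mx_form_eq0 => v w.
have E (a b : 'rV[R]_m) : (a *m (F p *m g p) *m b^T) ord0 ord0 = inner g p (a *m F p) b.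
  by rewrite innerE !mulmxA.
by rewrite mulmxDr mulmxDl mxE form_tr !E inner_skew inner_sym addNr.
Qed.

Variables (c0 : chart R m M).
Hypothesis c0a : atlas c0.
Let X := coord_field c0.
Let T q := jac c0 (chart_at q) id q.

(* Coefficients in the chart [c0] of the 2-form [Omega(X, Y) = g(FX, Y)]. *)
Definition form_mx (y : 'rV[R]_m) : 'M[R]_m :=
  let q := cinv c0 y in T q *m (F q *m g q) *m (T q)^T.

Lemma form_mxE (a b : 'rV[R]_m) y :
  (a *m form_mx y *m b^T) ord0 ord0 =
  inner g (cinv c0 y) (X a (cinv c0 y) *m F (cinv c0 y)) (X b (cinv c0 y)).
Proof. by rewrite innerE /form_mx /X /coord_field !trmx_mul !mulmxA. Qed.

Let XF a := fun q => X a q *m F q.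

Lemma coord_fieldF_smooth a : smooth_vf (cdom c0) (XF a).
Proof.
by case: hM => _ _ tF _; apply: tF; [exact: cdom_open|exact: coord_field_smooth].
Qed.

Lemma form_smooth_fun a b : smooth_fun (cdom c0) (fun q => inner g q (XF a q) (X b q)).
Proof.
case: hM => _ [_ _ sg] _ _; apply: sg; first exact: cdom_open.
- exact: coord_fieldF_smooth.
- exact: coord_field_smooth.
Qed.

(** The doubled [cdom c0] is the shape that smoothness on [cdom c0] takes in the chart [c0]
    itself. *)
Let V := cmap c0 @` (cdom c0 `&` cdom c0).

Lemma form_smooth (a b : 'rV[R]_m) : @smooth_on R m R^o V (fun y => (a *m form_mx y *m b^T) ord0 ord0).
Proof.
have -> : (fun y => (a *m form_mx y *m b^T) ord0 ord0 : R^o) =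
    ((fun q => inner g q (XF a q) (X b q)) \o cinv c0 : _ -> R^o).
  by apply/funext => y; rewrite form_mxE.
exact: form_smooth_fun c0a.
Qed.

Lemma nabla_coord_sym a b p : cdom c0 p -> nabla (X a) (X b) p = nabla (X b) (X a) p.
Proof.
move=> c0p; case: hnabla => _ tors _; apply/eqP; rewrite -subr_eq0; apply/eqP.
have sa := @coord_field_smooth R m M c0 c0a.
by rewrite (tors (cdom c0))//; [exact: lie_bracket_coord_field|exact: cdom_open].
Qed.

(** Metric compatibility splits the derivative of g(F X_a, X_b) in two; parallelism moves [nabla]
    inside [F], and skewness then moves [F] onto the other argument. *)
Lemma derive_form (a b c : 'rV[R]_m) p : cdom c0 p ->
  @derive R _ R^o (fun y => (a *m form_mx y *m b^T) ord0 ord0) (cmap c0 p) c =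
  inner g p (nabla (X c) (X b) p) (X a p *m F p) - inner g p (nabla (X c) (X a) p) (X b p *m F p).
Proof.
move=> c0p.
have -> : (fun y => (a *m form_mx y *m b^T) ord0 ord0 : R^o) =
    ((fun q => inner g q (XF a q) (X b q)) \o cinv c0 : _ -> R^o).
  by apply/funext => y; rewrite form_mxE.
have E := vf_deriv_coord_field c0a c (form_smooth_fun a b) c0p.
apply: etrans (esym E) _.
have sa := @coord_field_smooth R m M c0 c0a; have oc := @cdom_open _ _ _ c0.
case: hnabla => _ _ metric.
have Em := metric _ _ _ _ oc (sa c) (coord_fieldF_smooth a) (sa b) p c0p.
apply: etrans Em _.
have /eqP := hpar oc (sa c) (sa a) c0p; rewrite subr_eq0 => /eqP E2.
rewrite [nabla _ (XF a) p]E2 inner_skew addrC; congr (_ + _).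
exact: inner_sym.
Qed.

Theorem form_closed : closed_form V form_mx.
Proof.
have oV : open V by exact: (chart_image_open (c := c0) (@cdom_open _ _ _ c0)).
have entryE (A : 'M[R]_m) i j :
    A i j = ((delta_mx ord0 i : 'rV[R]_m) *m A *m (delta_mx ord0 j : 'rV[R]_m)^T) ord0 ord0.
  by rewrite trmx_delta -colE mxE -rowE mxE.
have sW : mx_smooth V form_mx.
  move=> i j; apply: (@smooth_on_ext _ _ _ oV R^o _ _ _ (form_smooth (delta_mx ord0 i) (delta_mx ord0 j))).
  by move=> y _; rewrite -entryE.
split=> //.
  by move=> y _; rewrite /form_mx !trmx_mul trmxK -trmx_mul Fg_skew mulNmx mulmxN mulmxA.
move=> _ [p [c0p _] <-] a b c.
have D (u v w : 'rV[R]_m) : (u *m mx_derive form_mx (cmap c0 p) w *m v^T) ord0 ord0 =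
   inner g p (nabla (X w) (X v) p) (X u p *m F p) - inner g p (nabla (X w) (X u) p) (X v p *m F p).
  rewrite -(derive_form u v w c0p).
  have Vp : V (cmap c0 p) by exists p.
  have su := mx_smooth_cst u oV; have sv := mx_smooth_cst v^T oV.
  have E1 := mx_derive_mul w su sW Vp; rewrite mx_derive_cst mul0mx add0r in E1.
  have suW := mx_smooth_mul oV su sW.
  have E2 := mx_derive_mul w suW sv Vp; rewrite mx_derive_cst mulmx0 addr0 E1 in E2.
  by rewrite -E2 mx_deriveE.
apply/matrixP => i j; rewrite !ord1 [RHS]mxE 2!mxE !D.
(* Coordinate fields have zero bracket, so a torsion-free [nabla] is symmetric on them and the six
   terms of the cyclic sum cancel in pairs. *)
rewrite (nabla_coord_sym c b c0p) (nabla_coord_sym c a c0p) (nabla_coord_sym b a c0p).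
by move: (inner _ _ _ _) (inner _ _ _ _) (inner _ _ _ _) => *; ring.
Qed.

End FundamentalForm.

(** * Frames of kernels and integral manifolds *)

Section KernelFrame.
Variables (R : realType) (n : nat).

Lemma open_nonzero (U : set 'rV[R]_n) (f : 'rV[R]_n -> R^o) :
  open U -> smooth_on U f -> open [set y | U y /\ f y != 0].
Proof.
move=> oU sf; rewrite openE => y [Uy fy].
have fy0 : 0 < `|f y : R| by rewrite normr_gt0.
have cf : {for y, continuous f} by apply: differentiable_continuous; exact: smooth_on_diff sf Uy.
have /cvgrPdist_lt/(_ _ fy0) H := cf.
apply: filterS (filterI (open_near oU Uy) H) => z [Uz fz]; split=> //.
by apply: contraTneq fz => ->; rewrite subr0 ltxx.
Qed.

(* The kernel of a smooth family [A] of constant rank is spanned near [x0] by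
   the lower rows of the inverse of [row_mx (A y) Pi], for [Pi] completing the
   columns of [A x0] to a basis. *)
Lemma kernel_frame d (U : set 'rV[R]_n) (x0 : 'rV[R]_n) (A : 'rV[R]_n -> 'M[R]_(n, d)) :
  open U -> U x0 -> mx_smooth U A -> row_free (A x0)^T ->
  exists (k : nat) (Pi : 'M[R]_(n, k)) (V : set 'rV[R]_n) (Q : 'rV[R]_n -> 'M[R]_(k, n)),
  [/\ open V, V x0, V `<=` U, mx_smooth V Q &
    forall y, V y -> [/\ Q y *m A y = 0, Q y *m Pi = 1%:M &
      forall v : 'rV[R]_n, v *m A y = 0 -> v = v *m Pi *m Q y]].
Proof.
move=> oU Ux0 sA fA; set B := (A x0)^T.
pose C := row_base (B^C)%MS; pose k := \rank (B^C)%MS.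
have dk : (d + k)%N = n.
  rewrite /k mxrank_compl -/B (eqP fA) subnKC//.
  by rewrite -(eqP fA) rank_leq_col.
pose S y := row_mx (A y) C^T; pose S0 := S x0.
have S0T : S0^T = col_mx B C by rewrite /S0 /S tr_row_mx trmxK.
have full : row_full (col_mx B C).
  rewrite -col_leq_rank; have := addsmx_compl_full B; rewrite -col_leq_rank => /leq_trans; apply.
  by rewrite -addsmxE; apply: mxrankS; rewrite addsmxS// eq_row_base.
have rS0 : \rank S0 = n by rewrite -mxrank_tr S0T (eqP full).
have [S1 S01] : exists S1, S0 *m S1 = 1%:M by apply/row_freeP; rewrite /row_free rS0.
have [S2 S20] : exists S2, S2 *m S0 = 1%:M by apply/row_fullP; rewrite /row_full rS0 dk.
have S12 : S2 = S1 by rewrite -[S2]mulmx1 -S01 mulmxA S20 mul1mx.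
rewrite {}S12 {S2} in S20.
(* [S y] has d + k columns, equal to n only propositionally. Multiplying by the inverse [S1] of
   [S x0] gives a genuinely square matrix, the identity at [x0], whose determinant can be used. *)
pose P y := S y *m S1.
have sP : mx_smooth U P.
  apply: (mx_smooth_mul oU _ (mx_smooth_cst S1 oU)) => a b.
  case: (splitP b) => c cb.
    have -> : b = lshift k c by exact: val_inj.
    apply: (smooth_on_ext oU _ (sA a c)) => y _.
    by rewrite /S row_mxEl.
  have -> : b = rshift d c by exact: val_inj.
  apply: (smooth_on_ext oU _ (smooth_cst oU (C^T a c))) => y _.
  by rewrite /S row_mxEr.
have sdet := smooth_det oU sP.
pose V := [set y | U y /\ \det (P y) != 0].
have uP y : V y -> P y \in unitmx by case=> _; rewrite unitmxE unitfE.
have oV : open V by exact: open_nonzero oU sdet.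
have VU : V `<=` U by move=> y [].
have sPV : mx_smooth V P by move=> a b; exact: smooth_onS VU (sP a b).
pose S' y := S1 *m invmx (P y).
have SP y : P y *m S0 = S y by rewrite /P -mulmxA S20 mulmx1.
have SS' y : V y -> S y *m S' y = 1%:M by move=> Vy; rewrite /S' mulmxA mulmxV// uP.
have S'S y : V y -> S' y *m S y = 1%:M.
  by move=> Vy; rewrite -SP /S' -mulmxA (mulmxA (invmx _)) mulVmx ?uP// mul1mx.
pose Q y := row_mx (0 : 'M[R]_(k, d)) 1%:M *m S' y.
exists k, C^T, V, Q; split=> //.
- by split=> //; rewrite /P -/S0 S01 det1 oner_neq0.
- apply: (mx_smooth_mul oV (mx_smooth_cst _ oV)).
  apply: (mx_smooth_mul oV (mx_smooth_cst _ oV)).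
  exact: mx_smooth_inv.
move=> y Vy.
have QS : Q y *m S y = row_mx 0 1%:M by rewrite /Q -mulmxA S'S// mulmx1.
move: QS; rewrite /S mul_mx_row => /eq_row_mx[QA QC]; split=> // v vA.
(* A kernel vector is sent by [S y] to (0 | v Pi), so inverting [S y] recovers it from [v *m Pi] and
   the lower rows of the inverse. *)
have vS : v *m S y = v *m C^T *m row_mx 0 1%:M.
  by rewrite /S !mul_mx_row vA mulmx0 mulmx1.
by rewrite -[LHS]mulmx1 -(SS' y Vy) mulmxA vS -!mulmxA.
Qed.

End KernelFrame.

(** * Pointwise linear algebra of the anti-invariant space *)

Section LinearAlgebra.
Variables (R : realType) (m n d : nat).
Variables (g F : 'M[R]_m) (tm : 'M[R]_(n, m)) (E : 'M[R]_(d, n)).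
Hypotheses (gpos : forall v : 'rV[R]_m, v != 0 -> 0 < (v *m g *m v^T) ord0 ord0)
  (Fg : (F *m g)^T = - (F *m g)) (gT : g^T = g) (Fu : F \in unitmx)
  (tmf : row_free tm) (Ef : row_free E)
  (inv : (E *m tm *m F <= E *m tm)%MS).

(* [ann v]: the vector [v] is orthogonal to the span of the rows of [E]. *)
Let ann (v : 'rV[R]_n) := v *m (tm *m g *m tm^T) *m E^T = 0.
Hypothesis anti : forall v, ann v -> v *m tm *m F *m g *m tm^T = 0.

(** An invertible [F] preserves the rank of [E *m tm], so its restriction to the invariant space is
    onto. *)
Lemma invariant_frame : exists2 C : 'M[R]_d, C \in unitmx & E *m tm *m F = C *m (E *m tm).
Proof.
have [C CE] := submxP inv; exists C => //.
have rF : row_free F by rewrite row_free_unit.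
have rEtm : \rank (E *m tm) = d by rewrite mxrankMfree// (eqP Ef).
rewrite -row_free_unit /row_free eqn_leq rank_leq_row/=.
by rewrite -{1}rEtm -(mxrankMfree (E *m tm) rF) CE mxrankM_maxl.
Qed.

Lemma gFT : g *m F^T = - (F *m g).
Proof. by rewrite -Fg trmx_mul gT. Qed.

(** For the converse, g(Fv, e) = -g(v, Fe), and the vectors Fe exhaust the span of [E] because [C]
    is invertible. *)
Lemma annP v : ann v <-> v *m (tm *m (F *m g) *m tm^T *m E^T) = 0.
Proof.
split=> [/anti H|H]; first by rewrite !mulmxA H mul0mx.
have [C Cu CE] := invariant_frame.
have : v *m tm *m g *m (E *m tm *m F)^T = 0.
  rewrite !trmx_mul !mulmxA -(mulmxA (v *m tm)) gFT mulmxN !mulNmx.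
  by rewrite -!mulmxA; move: H; rewrite -!mulmxA => ->; rewrite oppr0.
rewrite CE trmx_mul !mulmxA => H2.
have : v *m tm *m g *m (E *m tm)^T *m C^T *m invmx C^T = 0 by rewrite H2 mul0mx.
rewrite mulmxK ?unitmx_tr// => H3.
by rewrite /ann; move: H3; rewrite trmx_mul !mulmxA.
Qed.

(** Together with [annP]: the form and its product with [E^T] have the same kernel. *)
Lemma ann_kernel v : ann v <-> v *m (tm *m (F *m g) *m tm^T) = 0.
Proof.
split=> [/anti|H]; first by rewrite !mulmxA.
by apply/annP; rewrite !mulmxA in H *; rewrite H mul0mx.
Qed.

(** If F e, with e in the span of [E], is orthogonal to all tangent vectors, it is orthogonal to
    itself, since invariance makes it tangent; positivity of [g] then kills it. *)
Lemma ann_rank : row_free (tm *m (F *m g) *m tm^T *m E^T)^T.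
Proof.
apply/inj_row_free => a.
rewrite !trmx_mul !trmxK -[g^T *m F^T]trmx_mul Fg !(mulmxN, mulNmx) => /eqP.
rewrite oppr_eq0 => /eqP H.
have [C Cu CE] := invariant_frame.
have H2 : a *m C *m E *m tm *m g *m tm^T = 0.
  have X : a *m (E *m tm *m F) *m g *m tm^T = 0 by rewrite -[RHS]H !mulmxA.
  by rewrite CE !mulmxA in X.
have b0 : a *m C *m E *m tm = 0.
  apply/eqP; apply: contraT => /gpos; set b := a *m C *m E.
  by rewrite trmx_mul mulmxA H2 mul0mx mxE ltxx.
move/eqP: b0; rewrite mulmx_free_eq0// mulmx_free_eq0// => /eqP aC.
by rewrite -[a]mulmx1 -(mulmxV Cu) mulmxA aC mul0mx.
Qed.

End LinearAlgebra.

(** * The open ball as a manifold with one chart *)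

Section BallManifold.
Variables (R : realType) (k : nat).

Lemma rV_second_countable : @second_countable 'rV[R]_k.
Proof.
pose f (z : 'rV[rat]_k * nat) : set 'rV[R]_k := ball (map_mx (@ratr R) z.1) (z.2.+1%:R^-1).
exists [set f z | z in [set: 'rV[rat]_k * nat]].
  exact: (card_le_trans (card_image_le _ _) (countableP _)).
split=> [_ [z _ <-]|x V /nbhs_ballP[e /= e0 xe]].
  by apply: ball_open; rewrite invr_gt0.
have [N Ne] : exists N, (N.+1%:R^-1 : R) < e / 2.
  have [//|N] := @ltr_add_invr R 0 (e / 2) _; first by rewrite divr_gt0.
  by rewrite add0r; exists N.
have N0 : 0 < (N.+1%:R^-1 : R) by rewrite invr_gt0.
have Hq j : exists q : rat, x ord0 j - N.+1%:R^-1 < ratr q :> R /\ ratr q < x ord0 j + N.+1%:R^-1.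
  have lt : x ord0 j - N.+1%:R^-1 < x ord0 j + N.+1%:R^-1.
    by rewrite ltrD2l (lt_trans _ N0)// oppr_lt0.
  have [q] := rat_in_itvoo lt; rewrite in_itv/= => /andP[a b].
  by exists q.
have [q qP] := choice Hq; pose Qv := \row_j q j.
have xq : ball (map_mx (@ratr R) Qv) (N.+1%:R^-1) x.
  split=> // i j; rewrite ord1 !mxE /ball/= ltr_distl.
  have [a b] := qP j; rewrite -ltrBlDr a; by rewrite ltrBlDr.
exists (f (Qv, N)); first by split; [exists (Qv, N)|].
apply: subset_trans xe => z qz.
apply: (le_ball (ltW (_ : N.+1%:R^-1 + N.+1%:R^-1 < e))).
  by rewrite (splitr e) ltrD.
exact: ball_triangle (ball_sym xq) qz.
Qed.

Variable (r : R).
Hypothesis r0 : 0 < r.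

(* [squeeze] and [unsqueeze] only need to be inverse homeomorphisms: an atlas
   with a single chart imposes no smoothness on that chart. *)
Definition squeeze (x : 'rV[R]_k) : 'rV[R]_k := (r / (1 + `|x|)) *: x.
Definition unsqueeze (y : 'rV[R]_k) : 'rV[R]_k := (r - `|y|)^-1 *: y.

Lemma norm_squeeze x : `|squeeze x| < r.
Proof.
have x0 : 0 < 1 + `|x| by rewrite ltr_pwDl.
rewrite /squeeze normrZ ger0_norm ?divr_ge0 ?ltW// -mulrA gtr_pMr//.
by rewrite mulrC ltr_pdivrMr// mul1r ltrDr.
Qed.

Lemma squeezeK x : unsqueeze (squeeze x) = x.
Proof.
have x0 : 0 < 1 + `|x| by rewrite ltr_pwDl.
rewrite /unsqueeze {2}/squeeze scalerA.
have -> : `|squeeze x| = r / (1 + `|x|) * `|x|.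
  by rewrite /squeeze normrZ ger0_norm ?divr_ge0 ?ltW.
rewrite (_ : _ * _ = 1) ?scale1r//.
have a0 : 1 + `|x| != 0 by rewrite gt_eqF.
have b0 : r != 0 by rewrite gt_eqF.
have -> : r - r / (1 + `|x|) * `|x| = r / (1 + `|x|) by field.
by rewrite mulVf// mulf_neq0// invr_neq0.
Qed.

Lemma unsqueezeK y : `|y| < r -> squeeze (unsqueeze y) = y.
Proof.
move=> yr; have y0 : 0 < r - `|y| by rewrite subr_gt0.
rewrite /squeeze {2}/unsqueeze scalerA.
have -> : `|unsqueeze y| = (r - `|y|)^-1 * `|y|.
  by rewrite /unsqueeze normrZ ger0_norm ?invr_ge0 ?ltW.
rewrite (_ : _ * _ = 1) ?scale1r//.
have a0 : r - `|y| != 0 by rewrite gt_eqF.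
have b0 : r != 0 by rewrite gt_eqF.
have -> : 1 + (r - `|y|)^-1 * `|y| = r / (r - `|y|).
  by rewrite -{1}(mulVf a0) -mulrDr subrK mulrC.
by rewrite invf_div mulrA [r * _]mulrC mulfK// divff.
Qed.

Lemma squeeze_image : squeeze @` [set: 'rV[R]_k] = [set y | `|y| < r].
Proof.
apply/seteqP; split=> [_ [x _ <-]|y yr]; first exact: norm_squeeze.
by exists (unsqueeze y) => //; exact: unsqueezeK.
Qed.

Lemma open_norm_ball : open [set y : 'rV[R]_k | `|y| < r].
Proof.
rewrite (_ : mkset _ = ball (0 : 'rV[R]_k) r); first exact: ball_open.
by apply/funext => y; rewrite -ball_normE/= sub0r normrN.
Qed.

Lemma continuous_squeeze : continuous squeeze.
Proof.
move=> x; have d0 : 1 + `|x| != 0 by rewrite gt_eqF// ltr_pwDl.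
have c1 : (1 + `|y| : R) @[y --> x] --> (1 + `|x| : R).
  exact: (@cvgD R R^o _ (nbhs x) _ (cst 1) (fun y => `|y|) _ _ (cvg_cst _) (@norm_continuous R _ x)).
have c2 : (r / (1 + `|y|) : R) @[y --> x] --> (r / (1 + `|x|) : R).
  exact: (@cvgM R _ (nbhs x) _ (cst r) _ _ _ (cvg_cst _) (cvgV d0 c1)).
exact: (cvgZ c2 (@cvg_id _ (nbhs x))).
Qed.

Lemma continuous_unsqueeze y : `|y| < r -> {for y, continuous unsqueeze}.
Proof.
move=> yr; have d0 : r - `|y| != 0 by rewrite gt_eqF// subr_gt0.
have c1 : (r - `|z| : R) @[z --> y] --> (r - `|y| : R).
  exact: (@cvgB R R^o _ (nbhs y) _ (cst r) (fun y => `|y|) _ _ (cvg_cst _) (@norm_continuous R _ y)).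
exact: (cvgZ (cvgV d0 c1) (@cvg_id _ (nbhs y))).
Qed.

Lemma ball_chart_dom : open [set: 'rV[R]_k]. Proof. exact: openT. Qed.
Lemma ball_chart_img : open (squeeze @` [set: 'rV[R]_k]).
Proof. by rewrite squeeze_image; exact: open_norm_ball. Qed.
Lemma ball_chart_cont x : (squeeze @` [set: 'rV[R]_k]) x -> {for x, continuous unsqueeze}.
Proof. by rewrite squeeze_image; exact: continuous_unsqueeze. Qed.

Definition ball_chart : chart R k 'rV[R]_k :=
  Chart ball_chart_dom ball_chart_img (fun x _ => squeezeK x)
    (fun x _ => @continuous_squeeze x) ball_chart_cont.

Lemma smooth_id (U : set 'rV[R]_k) : open U -> @smooth_on R k 'rV[R]_k U id.
Proof.
move=> oU; apply: smooth_rV => // j.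
pose G : set ('rV[R]_k -> R^o) := [set (fun y : 'rV[R]_k => y ord0 j : R^o)].
apply: (@alg_smooth _ _ _ oU G); last exact: alg_gen.
move=> _ ->; split=> [x _|v]; first exact: differentiable_coord.
apply: (alg_ext (alg_cst _ G (v ord0 j))) => x _.
have did : differentiable (id : 'rV[R]_k -> 'rV[R]_k) x by [].
have E := derive_entry v ord0 j did.
by apply: etrans E; rewrite derive_id.
Qed.

Lemma ball_chart_compatible c c' : [set ball_chart] c -> [set ball_chart] c' ->
  smooth_on (cmap c @` (cdom c `&` cdom c')) (cmap c' \o cinv c).
Proof.
move=> -> ->; have oI := chart_image_open (c := ball_chart) (@cdom_open _ _ _ ball_chart).
apply: (smooth_on_ext oI _ (smooth_id oI)) => _ [x _ <-].
by rewrite /= squeezeK.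
Qed.

(** The open ball of radius [r] carried by the whole space ['rV[R]_k]: its points need no membership
    proof, while the chart takes values exactly where gamma is controlled. *)
Definition ball_manifold : manifold R k :=
  @Manifold R k 'rV[R]_k [set ball_chart] (fun _ => ball_chart)
    (fun _ => erefl) (fun _ => I) ball_chart_compatible
    (@norm_hausdorff _ _) rV_second_countable.

End BallManifold.

(** * The leaf parametrised by gamma *)

Section IntegralManifold.
Variables (R : realType) (n k : nat) (N : manifold R n) (phi : chart R n N).
Hypothesis phia : atlas phi.
Variables (V : set 'rV[R]_n) (Q : 'rV[R]_n -> 'M[R]_(k, n)) (Pi : 'M[R]_(n, k))
  (r : R) (gamma : 'rV[R]_k -> 'rV[R]_n).
Hypotheses (oV : open V) (Vphi : V `<=` cmap phi @` cdom phi) (sQ : mx_smooth V Q)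
  (QPi : forall y, V y -> Q y *m Pi = 1%:M) (r0 : 0 < r)
  (flow : forall s, `|s| < r -> [/\ V (gamma s), differentiable gamma s &
     forall v, 'D_v gamma s = v *m Q (gamma s)]).

(* [Pi] inverts [gamma] up to a translation, whence the injectivity of the leaf. *)
Lemma flow_proj s : `|s| < r -> gamma s *m Pi - s = gamma 0 *m Pi.
Proof.
move=> sr; pose h (s : 'rV[R]_k) : 'rV[R]_k := gamma s *m Pi - s.
have dPi y : differentiable (fun y : 'rV[R]_n => y *m Pi) y /\
    forall v, 'D_v (fun y : 'rV[R]_n => y *m Pi) y = v *m Pi.
  apply: (@quadratic_differentiable R n k (fun y => y *m Pi) y Pi 0).
  have H (v : 'rV[R]_n) : `|(y + v) *m Pi - y *m Pi - v *m Pi| <= 0 * `|v| ^+ 2.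
    by rewrite mulmxDl [_ + v *m Pi]addrC addrK subrr normr0 mul0r.
  exact: filterE.
have dh x : `|x| < r -> differentiable h x /\ forall v, 'D_v h x = 0.
  move=> /flow[Vx dx dE]; have [dp pE] := dPi (gamma x).
  have dgp : differentiable (fun s => gamma s *m Pi) x.
    exact: (@differentiable_comp _ _ _ _ gamma (fun y => y *m Pi)).
  have did : differentiable (id : 'rV[R]_k -> 'rV[R]_k) x by [].
  split; first exact: (differentiableB dgp did).
  move=> v; have E : 'D_v (fun s => gamma s *m Pi) x = v.
    by rewrite (derive_chain v dx dp) dE pE -mulmxA QPi// mulmx1.
  have := deriveB (diff_derivable (v := v) dgp) (diff_derivable (v := v) did).
  by rewrite E derive_id subrr.
have tr (t : R) : 0 <= t <= 1 -> `|0 + t *: s| < r.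
  move=> /andP[t0 t1]; rewrite add0r normrZ ger0_norm//.
  by rewrite (le_lt_trans _ sr)// ler_piMl.
have := @mean_value_ineq R 1 k (fun t : R => h (0 + t *: s)) (fun=> 0) 0 1 0 ler01 (lexx _).
rewrite mul0r => H.
have : `|h (0 + 1 *: s) - h (0 + 0 *: s)| <= 0.
  apply: H => t t01; last by rewrite normr0.
  have [d dE] := dh _ (tr t t01).
  by have D := @is_derive_line R k 'rV[R]_k h 0 s t d; rewrite (dE s) in D.
by rewrite scale1r scale0r !add0r normr_le0 subr_eq0 /h subr0 => /eqP.
Qed.

Definition leaf (s : ball_manifold k r0) : N := cinv phi (gamma (squeeze r s)).

Lemma leaf_dom s : cdom phi (leaf s) /\ cmap phi (leaf s) = gamma (squeeze r s).
Proof.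
have [Vs _ _] := flow (norm_squeeze r0 s).
by have [q qp qE] := Vphi Vs; rewrite /leaf -qE cmapK.
Qed.

Lemma leaf_continuous : continuous leaf.
Proof.
move=> s; have [Vs ds _] := flow (norm_squeeze r0 s).
apply: (@continuous_comp _ _ _ (squeeze r) (cinv phi \o gamma)).
  exact: continuous_squeeze.
apply: (@continuous_comp _ _ _ gamma (cinv phi)); first exact: differentiable_continuous.
by apply: cinv_continuous; exact: Vphi.
Qed.

Lemma leaf_smooth : smooth_map leaf.
Proof.
split=> [|c c' -> ca']; first exact: leaf_continuous.
set B := _ @` _.
have oB : open B.
  apply: (chart_image_open (c := ball_chart k r0)).
  apply: open_comp; last exact: (@cdom_open _ _ _ c').
  by move=> x _; exact: leaf_continuous.
pose V' := V `&` (cmap phi @` (cdom phi `&` cdom c')).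
have oV' : open V'.
  by apply: openI => //; exact: (chart_image_open (c := phi) (@cdom_open _ _ _ c')).
have sQ' : mx_smooth V' Q by move=> a b; apply: smooth_onS (sQ a b) => y [].
have sc' : smooth_on V' (cmap c' \o cinv phi).
  by apply: smooth_onS (atlas_compatible phia ca') => y [].
have flow' s : B s -> [/\ V' (gamma s), differentiable gamma s & forall v, 'D_v gamma s = v *m Q (gamma s)].
  move=> [x [_ xc'] <-]; have [Vs ds dE] := flow (norm_squeeze r0 x); split=> //.
  split=> //; have [lp lE] := leaf_dom x.
  by exists (leaf x).
apply: (smooth_on_ext oB _ (smooth_flow oB oV' sQ' flow' sc')).
by move=> _ [x [_ xc'] <-]; rewrite /= /leaf (squeezeK r0).
Qed.

Lemma leaf_tangent s :
  tangent_map leaf s = Q (cmap phi (leaf s)) *m jac phi (chart_at (leaf s)) id (leaf s).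
Proof.
have [lp lE] := leaf_dom s.
have -> : tangent_map leaf s = jac (chart_at s) (chart_at (leaf s)) (id \o leaf) s.
  by rewrite jacE.
rewrite (jac_comp (c' := phi) leaf_smooth (smooth_map_id N))//; last 2 first.
- exact: chart_at_atlas.
- exact: chart_at_dom.
congr (_ *m _); rewrite jacE lE.
have [Vs ds dE] := flow (norm_squeeze r0 s).
have -> : 'J (cmap phi \o leaf \o cinv (chart_at s)) (cmap (chart_at s) s) =
    'J gamma (squeeze r s).
  apply: esym; apply: (jacobian_eq_on (@open_norm_ball R k r) _ (norm_squeeze r0 s) ds).
  move=> y yr; rewrite /=; have [_ ->] := leaf_dom (unsqueeze r y).
  by rewrite unsqueezeK.
apply/row_matrixP => a; apply: etrans (rowE a _) (etrans _ (esym (rowE a _))).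
by rewrite -dE; apply: esym; exact: deriveEjacobian.
Qed.

Lemma leaf_submanifold : submanifold leaf.
Proof.
split; first exact: leaf_smooth.
- move=> s s' ss'; have [_ lE] := leaf_dom s; have [_ lE'] := leaf_dom s'.
  have E : gamma (squeeze r s) = gamma (squeeze r s') by rewrite -lE -lE' ss'.
  have := flow_proj (norm_squeeze r0 s); rewrite -(flow_proj (norm_squeeze r0 s')) E.
  by move=> /addrI/oppr_inj/(congr1 (unsqueeze r)); rewrite !squeezeK.
- move=> s; rewrite leaf_tangent; have [lp lE] := leaf_dom s.
  have [Vs _ _] := flow (norm_squeeze r0 s).
  have ca := chart_at_atlas (leaf s); have cd := chart_at_dom (leaf s).
  (* Undoing the chart change and then applying [Pi] is a right inverse of the tangent map, because
     Q Pi = 1. *)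
  apply/row_freeP; exists (jac (chart_at (leaf s)) phi id (leaf s) *m Pi).
  by rewrite -mulmxA (mulmxA (jac phi _ _ _)) jac_inv// mul1mx lE QPi.
Qed.

End IntegralManifold.

(** * The anti-invariant distribution *)

Lemma closed_formS (R : realType) n (U V : set 'rV[R]_n) (w : 'rV[R]_n -> 'M[R]_n) :
  V `<=` U -> closed_form U w -> closed_form V w.
Proof.
move=> VU [sw skw clw]; split=> [a b|y /VU|y /VU]; [|exact: skw|exact: clw].
exact: smooth_onS VU (sw a b).
Qed.

Section SemiInvariant.
Variables (R : realType) (m n d : nat) (M : manifold R m) (N : manifold R n).
Variables (g F : M -> 'M[R]_m) (i : N -> M) (D : N -> set 'rV[R]_n).
Hypotheses (hM : gFmu_manifold g F 1) (hF : nondegenerate_tensor F)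
  (hN : submanifold i) (hD : semi_invariant g F i D).
Variables (E : N -> 'M[R]_(d, n)) (q : N).
Hypotheses (Ef : row_free (E q)) (DE : D q = [set v | (v <= E q)%MS]).

Let tm := tangent_map i q.
Let Dperp := orth_complement (induced_metric g i) D.

Lemma metric_tr (y : M) : (g y)^T = g y.
Proof.
case: hM => _ [gsym _ _] _ _; apply/eqP; rewrite -subr_eq0; apply/eqP.
apply: mx_form_eq0 => v w; rewrite mulmxBr mulmxBl form_tr mxE [X in _ + X]mxE.
by apply/eqP; rewrite subr_eq0; apply/eqP; exact: gsym.
Qed.

Lemma dperpP v : Dperp q v <-> v *m (tm *m g (i q) *m tm^T) *m (E q)^T = 0.
Proof.
split=> [H|H w].
  apply/rowP => a; have /H : D q (row a (E q)) by rewrite DE /=; exact: row_sub.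
  by rewrite /inner /induced_metric -/tm tr_row colE mulmxA -colE mxE => ->; rewrite mxE.
rewrite DE => /submxP[C ->]; rewrite /inner trmx_mul mulmxA.
by rewrite -/tm /induced_metric -/tm H mul0mx mxE.
Qed.

Lemma anti_invariant v : Dperp q v -> v *m tm *m F (i q) *m g (i q) *m tm^T = 0.
Proof.
case: hD => _ _ anti _ Dv.
have nrm : Defs.normal_space g i q (v *m tm *m F (i q)) by apply: anti; exists v.
apply/rowP => a; have := nrm (delta_mx ord0 a).
by rewrite /inner trmx_mul trmx_delta mulmxA -colE !mxE.
Qed.

Lemma invariantP : (E q *m tm *m F (i q) <= E q *m tm)%MS.
Proof.
case: hD => _ inv _ _; apply/row_subP => a.
have Da : D q (row a (E q)) by rewrite DE /=; exact: row_sub.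
have [v] : [set v *m tangent_map i q | v in D q] (row a (E q) *m tm *m F (i q)).
  by apply: inv; exists (row a (E q)).
by rewrite DE !row_mul => /= vE <-; exact: submxMr.
Qed.

Let metric_pos (v : 'rV[R]_m) : v != 0 -> 0 < (v *m g (i q) *m v^T) ord0 ord0.
Proof. by have [_ [_ pos _] _ _] := hM; exact: pos. Qed.

Let tm_free : row_free tm. Proof. by have [_ _ imm] := hN; exact: imm. Qed.

Let anti' (v : 'rV[R]_n) : v *m (tm *m g (i q) *m tm^T) *m (E q)^T = 0 ->
  v *m tm *m F (i q) *m g (i q) *m tm^T = 0.
Proof. by move=> /dperpP; exact: anti_invariant. Qed.

Lemma dperp_frame v :
  Dperp q v <-> v *m (tm *m (F (i q) *m g (i q)) *m tm^T *m (E q)^T) = 0.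
Proof.
apply: (iff_trans (dperpP v)).
exact: (annP (Fg_skew hM (i q)) (metric_tr (i q)) (hF (i q)) tm_free Ef invariantP anti').
Qed.

Lemma dperp_kernel v :
  Dperp q v <-> v *m (tm *m (F (i q) *m g (i q)) *m tm^T) = 0.
Proof.
apply: (iff_trans (dperpP v)).
exact: (ann_kernel (Fg_skew hM (i q)) (metric_tr (i q)) (hF (i q)) tm_free Ef invariantP anti').
Qed.

Lemma dperp_rank : row_free (tm *m (F (i q) *m g (i q)) *m tm^T *m (E q)^T)^T.
Proof.
exact: (ann_rank metric_pos (Fg_skew hM (i q)) (hF (i q)) tm_free Ef invariantP).
Qed.

Variables (phi : chart R n N) (psi : chart R m M).
Hypotheses (phia : atlas phi) (psia : atlas psi) (qphi : cdom phi q)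
  (qpsi : cdom psi (i q)).
Let f := cmap psi \o i \o cinv phi.
Let tau := jac phi (chart_at q) id q.

(** The Jacobian of [i] from [phi] to [chart_at (i q)] factors through [psi], where the form is
    computed, and through [chart_at q], where [tangent_map] lives; comparing the factorisations
    gives the identity. *)
Lemma pullback_form : let x := cmap phi q in
  'J f x *m form_mx g F psi (f x) *m ('J f x)^T =
  tau *m (tm *m (F (i q) *m g (i q)) *m tm^T) *m tau^T.
Proof.
move=> x; have si : smooth_map i by case: hN.
have ca := chart_at_atlas q; have cq := chart_at_dom q.
have ca' := chart_at_atlas (i q); have cq' := chart_at_dom (i q).
have Jf : 'J f x = jac phi psi i q by rewrite jacE.
have fx : cinv psi (f x) = i q by rewrite /f /x /= (cmapK qphi) (cmapK qpsi).
pose sig := jac psi (chart_at (i q)) id (i q).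
have H1 : jac phi (chart_at (i q)) i q = jac phi psi i q *m sig.
  exact: (jac_comp si (smooth_map_id M) phia psia ca' qphi qpsi cq').
have H2 : jac phi (chart_at (i q)) i q = tau *m tm.
  have -> : tm = jac (chart_at q) (chart_at (i q)) i q by rewrite jacE.
  exact: (jac_comp (smooth_map_id N) si phia ca ca' qphi cq cq').
rewrite /form_mx fx -/sig Jf.
have -> : jac phi psi i q *m (sig *m (F (i q) *m g (i q)) *m sig^T) *m (jac phi psi i q)^T =
   (jac phi psi i q *m sig) *m (F (i q) *m g (i q)) *m (jac phi psi i q *m sig)^T.
  by rewrite trmx_mul !mulmxA.
by rewrite -H1 H2 trmx_mul !mulmxA.
Qed.

(** The frame changes by the inverse Jacobian, so the right-hand [tau] of the form cancels and only
    the left one remains in the product. *)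
Lemma frame_in_chart : tau^T *m (E q *m jac (chart_at q) phi id q)^T = (E q)^T.
Proof.
rewrite -trmx_mul -mulmxA jac_inv ?mulmx1//.
- exact: chart_at_atlas.
- exact: chart_at_dom.
Qed.

End SemiInvariant.

Theorem theorem4p4 (R : realType) (m n : nat)
    (M : manifold R m) (g F : M -> 'M[R]_m)
    (nabla : (M -> 'rV[R]_m) -> (M -> 'rV[R]_m) -> M -> 'rV[R]_m)
    (N : manifold R n) (i : N -> M) (D : N -> set 'rV[R]_n)
    (hM : gFmu_manifold g F 1)
    (hF : nondegenerate_tensor F)
    (hnabla : levi_civita g nabla)
    (hpar : parallel nabla F)
    (hN : submanifold i)
    (hD : semi_invariant g F i D) :
  integrable_distribution (orth_complement (induced_metric g i) D).
Proof.
move=> p.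
have si : smooth_map i by case: hN.
have [[d frameD] _ _ _] := hD.
have [U0 [E [oU0 U0p sE EP]]] := frameD p.
pose phi := chart_at p; pose psi := chart_at (i p).
have phia : atlas phi by exact: chart_at_atlas.
have psia : atlas psi by exact: chart_at_atlas.
(* Here [D] has the frame [E] and [i] takes values in the single chart [psi]. *)
pose O := U0 `&` i @^-1` cdom psi.
have oO : open O.
  apply: openI => //; apply: open_comp; last exact: (@cdom_open _ _ _ psi).
  by move=> x _; exact: si.1.
pose V0 := cmap phi @` (cdom phi `&` O).
have oV0 : open V0 by exact: (chart_image_open (c := phi) oO).
pose f := cmap psi \o i \o cinv phi.
have sf : smooth_on V0 f.
  apply: smooth_onS (si.2 phi psi phia psia) => _ [q [qphi [_ qpsi]] <-].
  by exists q.
pose Vp := cmap psi @` (cdom psi `&` cdom psi).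
have oVp : open Vp by exact: (chart_image_open (c := psi) (@cdom_open _ _ _ psi)).
have fV x : V0 x -> Vp (f x).
  move=> [q [qphi [_ qpsi]] <-]; exists (i q) => //.
  by rewrite /f /= (cmapK qphi).
pose w x := 'J f x *m form_mx g F psi (f x) *m ('J f x)^T.
have clw : closed_form V0 w.
  exact: (closed_form_pullback oV0 oVp sf fV (form_closed hM hnabla hpar psia)).
(* The frame in the chart [phi], spelled as in [vf_in_chart] so that its rows are smooth by the
   hypothesis on [E]. *)
pose Eh x : 'M[R]_(d, n) := E (cinv phi x) *m
  'J (cmap phi \o cinv (chart_at (cinv phi x))) (cmap (chart_at (cinv phi x)) (cinv phi x)).
have sEh : mx_smooth V0 Eh.
  move=> a j.
  have sa : smooth_on V0 (vf_in_chart (fun q => row a (E q)) phi).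
    by apply: smooth_onS (sE a phi phia) => _ [q [qphi [qU _]] <-]; exists q.
  apply: (smooth_on_ext oV0 _ (smooth_entry ord0 j oV0 sa)) => y _.
  by rewrite /vf_in_chart /Eh -row_mul mxE.
pose A x := w x *m (Eh x)^T.
have [sw _ _] := clw.
have sA : mx_smooth V0 A by exact: (mx_smooth_mul oV0 sw (mx_smooth_tr oV0 sEh)).
pose Dperp := orth_complement (induced_metric g i) D.
pose B q := tangent_map i q *m (F (i q) *m g (i q)) *m (tangent_map i q)^T.
pose tau q := jac phi (chart_at q) id q.
have wE q : cdom phi q -> O q -> w (cmap phi q) = tau q *m B q *m (tau q)^T.
  move=> qphi [_ qpsi].
  exact: (pullback_form g F hN phia psia qphi qpsi).
have AE q : cdom phi q -> O q -> A (cmap phi q) = tau q *m (B q *m (E q)^T).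
  move=> qphi qO; rewrite /A wE// /Eh (cmapK qphi) -jac_idE.
  by rewrite -!mulmxA (frame_in_chart E phia qphi).
have tauu q : cdom phi q -> tau q \in unitmx.
  by move=> qphi; apply: jac_unit => //; [exact: chart_at_atlas|exact: chart_at_dom].
have kerA q (v : 'rV[R]_n) : cdom phi q -> O q ->
    v *m A (cmap phi q) = 0 <-> Dperp q (v *m tau q).
  move=> qphi qO; have [Ef DE] := EP q qO.1.
  rewrite AE// mulmxA; apply: iff_sym.
  exact: (dperp_frame hM hF hN hD Ef DE).
have kerw q (v : 'rV[R]_n) : cdom phi q -> O q ->
    v *m w (cmap phi q) = 0 <-> Dperp q (v *m tau q).
  move=> qphi qO; have [Ef DE] := EP q qO.1.
  have Dk := dperp_kernel hM hF hN hD Ef DE (v *m tau q).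
  rewrite wE// (mulmxA v) (mulmxA v); split=> [H|/Dk H]; last by rewrite -/(B q) in H; rewrite H mul0mx.
  have tu : (tau q)^T \in unitmx by rewrite unitmx_tr tauu.
  by apply/Dk; rewrite -/(B q) -[LHS](mulmxK tu) H mul0mx.
have pphi : cdom phi p by exact: chart_at_dom.
have pO : O p by split => //; exact: chart_at_dom.
have x0V : V0 (cmap phi p) by exists p.
have rA : row_free (A (cmap phi p))^T.
  have [Ef DE] := EP p U0p; rewrite AE// trmx_mul /row_free mxrankMfree; last first.
    by rewrite row_free_unit unitmx_tr tauu.
  exact: (dperp_rank hM hF hN hD Ef DE).
have [k [Pi [V [Q [oV Vx0 VV0 sQ QP]]]]] := kernel_frame oV0 x0V sA rA.
have QA y : V y -> Q y *m A y = 0 by move=> /QP[].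
have QPi y : V y -> Q y *m Pi = 1%:M by move=> /QP[].
have AQ y (v : 'rV[R]_n) : V y -> v *m A y = 0 -> v = v *m Pi *m Q y.
  by move=> /QP[_ _ H]; exact: H.
(* The kernel frame comes from [A] and closedness from [w]; [Dperp] mediates between their
   kernels. *)
have kerAw y (v : 'rV[R]_n) : V y -> v *m A y = 0 <-> v *m w y = 0.
  move=> /VV0[q [qphi qO] <-].
  exact: (iff_trans (kerA q v qphi qO) (iff_sym (kerw q v qphi qO))).
have Qw y : V y -> Q y *m w y = 0.
  move=> Vy; apply/row_matrixP => a; rewrite row_mul row0.
  by apply/(kerAw _ _ Vy); rewrite -row_mul QA// row0.
have wQ y : V y -> forall v : 'rV[R]_n, v *m w y = 0 -> exists a, v = a *m Q y.
  by move=> Vy v /(kerAw _ _ Vy)/(AQ _ _ Vy) ->; exists (v *m Pi).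
have comm := closed_form_kernel_involutive oV (closed_formS VV0 clw) sQ Qw wQ QPi.
have [r [gamma [r0 gamma0 flow]]] := frobenius_commuting oV Vx0 sQ comm.
have Vphi : V `<=` cmap phi @` cdom phi by move=> _ /VV0[q [qphi _] <-]; exists q.
pose j := @leaf R n k N phi r gamma r0.
have jdom s : cdom phi (j s) /\ cmap phi (j s) = gamma (squeeze r s).
  exact: (leaf_dom Vphi flow).
have jV s : V (cmap phi (j s)).
  by have [_ ->] := jdom s; have [] := flow _ (norm_squeeze r0 s).
exists k, (ball_manifold k r0), j; split.
- exact: (leaf_submanifold phia oV Vphi sQ QPi r0 flow).
- exists (0 : 'rV[R]_k); have [_ jE] := jdom (0 : 'rV[R]_k).
  by rewrite /j /leaf /squeeze scaler0 gamma0 (cmapK pphi).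
move=> s; have Vs := jV s.
have tE : tangent_map j s = Q (cmap phi (j s)) *m tau (j s).
  exact: (leaf_tangent phia oV Vphi sQ flow).
have [jphi _] := jdom s.
have jO : O (j s).
  have [q [qphi qO] qE] := VV0 _ Vs.
  by rewrite -(cmapK jphi) -qE (cmapK qphi).
rewrite tE; apply/seteqP; split=> [_ [v _ <-]|v Dv] /=.
  rewrite mulmxA; apply/(kerA _ _ jphi jO).
  by rewrite -mulmxA QA// mulmx0.
have vE : v = v *m invmx (tau (j s)) *m tau (j s) by rewrite mulmxKV// tauu.
have : Dperp (j s) (v *m invmx (tau (j s)) *m tau (j s)) by rewrite -vE.
move=> /(kerA _ _ jphi jO)/(AQ _ _ Vs) uE.
(* Once [v] is written in the chart [phi], [Pi] reads off its coefficients along the rows of [Q]. *)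
exists (v *m invmx (tau (j s)) *m Pi) => //.
by rewrite mulmxA -uE -vE.
Qed.
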